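(* Let $\mathfrak s$ be a $6$-dimensional real Lie algebra with a non-proper abelian complex structure $J$. Then: \begin{enumerate} \item[(i)] $\dim\mathfrak s'=3$ and $(\mathfrak s,J)$ is holomorphically isomorphic to $\mathfrak{aff}(A)$ with its standard complex structure, where $A$ is a $3$-dimensional commutative associative real algebra such that $A^2=A$; \item[(ii)] $(\mathfrak s,J)$ is holomorphically isomorphic to one and only one of the following: \begin{enumerate} \item[(1)] $\mathfrak{aff}(\mathbb R)\times\mathfrak{aff}(\mathbb R)\times\mathfrak{aff}(\mathbb R)$, where each factor carries its unique complex structure; \item[(2)] $\mathfrak{aff}(\mathbb R)\times\mathfrak{aff}(\mathbb C)$, where the first factor carries its unique complex structure and the second factor is equipped with $J_2$; \item[(3)] $\mathfrak{aff}(\mathbb R)\times(\mathfrak{aff}(\mathbb R)\ltimes_{\mathrm{ad}}\mathbb R^2)$, where each factor is equipped with its unique abelian complex structure; \item[(4)] $(\mathfrak s_3,J)$ with basis $e_1,e_2,e_3,f_1,f_2,f_3$: $[e_1,f_i]=f_i$ for $i=1,2,3$, $[e_2,f_1]=f_2$, $[e_2,f_2]=f_3$, $[e_3,f_1]=f_3$; $Je_i=f_i$, $i=1,2,3$; \item[(5)] $(\mathfrak s_4,J)$ with basis $e_1,e_2,e_3,f_1,f_2,f_3$: $[e_1,f_i]=f_i$ for $i=1,2,3$, $[e_2,f_1]=f_2$, $[e_3,f_1]=f_3$; $Je_i=f_i$, $i=1,2,3$. \end{enumerate} \end{enumerate}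
   Context: An abelian complex structure on a real Lie algebra $\mathfrak g$ is a linear endomorphism $J$ with $J^2=-I$ and $[Jx,Jy]=[x,y]$ for all $x,y\in\mathfrak g$. Write $\mathfrak s'=[\mathfrak s,\mathfrak s]$ and $\mathfrak s'_J=\mathfrak s'+J\mathfrak s'$; $J$ is proper if $\mathfrak s'_J\subsetneq\mathfrak s$, and non-proper if $\mathfrak s'_J=\mathfrak s$. Two pairs $(\mathfrak g_1,J_1)$, $(\mathfrak g_2,J_2)$ are holomorphically isomorphic if there is a Lie algebra isomorphism $\alpha:\mathfrak g_1\to\mathfrak g_2$ with $J_2\alpha=\alpha J_1$. ''Unique'' means unique up to automorphisms of the Lie algebra. For a commutative associative algebra $A$, $\mathfrak{aff}(A)=A\oplus A$ with Lie bracket $[(x,y),(x',y')]=(0,xy'-x'y)$ and standard complex structure $J(x,y)=(-y,x)$. $A^2$ denotes the span of all products. Nonzero brackets (up to skew-symmetry) and complex structures on the factors: $\mathfrak{aff}(\mathbb R)$: $[e_1,e_2]=e_2$, $Je_1=e_2$; $\mathfrak{aff}(\mathbb R)\ltimes_{\mathrm{ad}}\mathbb R^2$: $[e_1,e_2]=e_2$, $[e_1,e_4]=e_4$, $[e_2,e_3]=e_4$, $Je_1=e_2$, $Je_3=-e_4$; $\mathfrak{aff}(\mathbb C)$: $[e_1,e_3]=e_3$, $[e_1,e_4]=e_4$, $[e_2,e_3]=e_4$, $[e_2,e_4]=-e_3$, with $J_2e_1=e_3$, $J_2e_2=e_4$. Products carry the product complex structure. *)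

(* Defs.v *)
From HB Require Import structures.
From mathcomp Require Import all_boot all_order all_algebra.
From mathcomp Require Import ring.

Set Implicit Arguments.
Unset Strict Implicit.
Unset Printing Implicit Defensive.

Import GRing.Theory.
Local Open Scope ring_scope.

HB.mixin Record Vector_isLie (R : fieldType) V of Vector R V := {
  lieb : V -> V -> V;
  lieb_linearl : forall (a : R) (x y z : V),
    lieb (a *: x + y) z = a *: lieb x z + lieb y z;
  lieb_linearr : forall (a : R) (x y z : V),
    lieb x (a *: y + z) = a *: lieb x y + lieb x z;
  liebxx : forall x : V, lieb x x = 0;
  lieb_jacobi : forall x y z : V,
    lieb x (lieb y z) + lieb y (lieb z x) + lieb z (lieb x y) = 0
}.

#[short(type="lieAlgType")]
HB.structure Definition LieAlgebra (R : fieldType) :=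
  {V of Vector R V & Vector_isLie R V}.

(* No unit is assumed, unlike in comAlgType. *)
HB.mixin Record Vector_isComAssoc (R : fieldType) V of Vector R V := {
  amul : V -> V -> V;
  amul_linearl : forall (a : R) (x y z : V),
    amul (a *: x + y) z = a *: amul x z + amul y z;
  amulC : commutative amul;
  amulA : associative amul
}.

#[short(type="comAssocAlgType")]
HB.structure Definition ComAssocAlgebra (R : fieldType) :=
  {V of Vector R V & Vector_isComAssoc R V}.

Section ProductSpan.
Variables (R : fieldType) (V : vectType R) (f : V -> V -> V).

(* The span of all the values of a bilinear f, as for prodv in falgebra;
   mem_prodspan and prodspan_min show that the choice of basis is irrelevant. *)
Definition prodspan : {vspace V} :=
  <<[seq f x y | x <- vbasis fullv, y <- vbasis fullv]>>%VS.

Hypothesis linl : forall a x y z, f (a *: x + y) z = a *: f x z + f y z.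
Hypothesis linr : forall a x y z, f x (a *: y + z) = a *: f x y + f x z.

Lemma mem_prodspan x y : f x y \in prodspan.
Proof.
have f0y z : f 0 z = 0.
  by apply: (addIr (f 0 z)); rewrite -[X in X + _]scale1r -linl scaler0 !add0r.
have fx0 z : f z 0 = 0.
  by apply: (addIr (f z 0)); rewrite -[X in X + _]scale1r -linr scaler0 !add0r.
rewrite (coord_vbasis (memvf x)).
elim/big_rec: _ => [|i u _ uP]; first by rewrite f0y mem0v.
rewrite linl memvD ?memvZ //.
rewrite (coord_vbasis (memvf y)).
elim/big_rec: _ => [|j v _ vP]; first by rewrite fx0 mem0v.
rewrite linr memvD ?memvZ // memv_span //.
by apply: allpairs_f; apply: mem_nth; rewrite size_tuple.
Qed.

Lemma prodspan_min (U : {vspace V}) :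
  (forall x y, f x y \in U) -> (prodspan <= U)%VS.
Proof. by move=> fU; apply/span_subvP => _ /allpairsP[p [_ _ ->]]. Qed.

End ProductSpan.

Definition derived (R : fieldType) (s : lieAlgType R) : {vspace s} :=
  prodspan (@lieb R s).

Definition alg_square (R : fieldType) (A : comAssocAlgType R) : {vspace A} :=
  prodspan (@amul R A).

Section ComplexStructures.
Variables (R : fieldType) (s : lieAlgType R).
Implicit Type J : 'End(s).

(* Integrability is the vanishing of the Nijenhuis tensor. *)
Definition complex_structure J : Prop :=
  (J \o J)%VF = - \1%VF /\
  forall x y : s,
    lieb (J x) (J y) - lieb x y - J (lieb (J x) y) - J (lieb x (J y)) = 0.

Definition abelian_complex_structure J : Prop :=
  (J \o J)%VF = - \1%VF /\ forall x y : s, lieb (J x) (J y) = lieb x y.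

Definition non_proper J : Prop := (derived s + J @: derived s)%VS = fullv.

End ComplexStructures.

Definition lie_isomorphism (R : fieldType) (g1 g2 : lieAlgType R)
    (alpha : 'Hom(g1, g2)) : Prop :=
  bijective alpha /\ forall x y : g1, alpha (lieb x y) = lieb (alpha x) (alpha y).

Definition hol_isomorphic (R : fieldType) (g1 g2 : lieAlgType R)
    (J1 : 'End(g1)) (J2 : 'End(g2)) : Prop :=
  exists2 alpha : 'Hom(g1, g2),
    lie_isomorphism alpha & (J2 \o alpha)%VF = (alpha \o J1)%VF.

(* For g1 = g2 = g, hol_isomorphic J1 J2 says that J1 and J2 are conjugate
   under an automorphism of the Lie algebra g. *)
Definition unique_up_to_aut (R : fieldType) (g : lieAlgType R)
    (P : 'End(g) -> Prop) (J : 'End(g)) : Prop :=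
  P J /\ forall J', P J' -> hol_isomorphic J' J.

Section Product.
Variables (R : fieldType) (g1 g2 : lieAlgType R).

Definition prod_lieb (u v : g1 * g2) : g1 * g2 :=
  (lieb u.1 v.1, lieb u.2 v.2).

Fact prod_lieb_linearl (a : R) (x y z : g1 * g2) :
  prod_lieb (a *: x + y) z = a *: prod_lieb x z + prod_lieb y z.
Proof. by rewrite /prod_lieb /= !lieb_linearl. Qed.

Fact prod_lieb_linearr (a : R) (x y z : g1 * g2) :
  prod_lieb x (a *: y + z) = a *: prod_lieb x y + prod_lieb x z.
Proof. by rewrite /prod_lieb /= !lieb_linearr. Qed.

Fact prod_liebxx (x : g1 * g2) : prod_lieb x x = 0.
Proof. by rewrite /prod_lieb !liebxx. Qed.

Fact prod_lieb_jacobi (x y z : g1 * g2) :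
  prod_lieb x (prod_lieb y z) + prod_lieb y (prod_lieb z x) +
  prod_lieb z (prod_lieb x y) = 0.
Proof. by congr (_, _); rewrite /= lieb_jacobi. Qed.

HB.instance Definition _ := Vector_isLie.Build R (g1 * g2)%type
  prod_lieb_linearl prod_lieb_linearr prod_liebxx prod_lieb_jacobi.

Variables (J1 : 'End(g1)) (J2 : 'End(g2)).

Definition prod_J_fun (u : g1 * g2) : g1 * g2 := (J1 u.1, J2 u.2).

Fact prod_J_is_linear : linear prod_J_fun.
Proof. by move=> a u v; rewrite /prod_J_fun /= !linearP. Qed.

HB.instance Definition _ :=
  GRing.isLinear.Build R _ _ _ prod_J_fun prod_J_is_linear.

Definition prod_J : 'End((g1 * g2)%type) := linfun prod_J_fun.

Lemma prod_JE u : prod_J u = (J1 u.1, J2 u.2).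
Proof. by rewrite lfunE. Qed.

End Product.

Definition aff (R : fieldType) (A : comAssocAlgType R) : Type := (A * A)%type.

HB.instance Definition _ (R : fieldType) (A : comAssocAlgType R) :=
  Vector.copy (aff A) (A * A)%type.

Section Aff.
Variables (R : fieldType) (A : comAssocAlgType R).

Definition aff_lieb (u v : aff A) : aff A :=
  (0, amul u.1 v.2 - amul v.1 u.2).

Let amul_linearr (a : R) (x y z : A) :
  amul x (a *: y + z) = a *: amul x y + amul x z.
Proof. by rewrite amulC amul_linearl !(amulC _ x). Qed.

Let amul0r (x : A) : amul 0 x = 0.
Proof.
apply: (addIr (amul 0 x)).
by rewrite -[X in X + _]scale1r -amul_linearl scaler0 !add0r.
Qed.

Let amulBr (x y z : A) : amul x (y - z) = amul x y - amul x z.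
Proof. by rewrite addrC -scaleN1r amul_linearr scaleN1r addrC. Qed.

Fact aff_lieb_linearl (a : R) (x y z : aff A) :
  aff_lieb (a *: x + y) z = a *: aff_lieb x z + aff_lieb y z.
Proof.
congr (_, _); rewrite /= ?scaler0 ?addr0 // amul_linearl amul_linearr.
by rewrite opprD addrACA scalerBr.
Qed.

Fact aff_liebxx (x : aff A) : aff_lieb x x = 0.
Proof. by rewrite /aff_lieb subrr. Qed.

Let aff_liebC (x y : aff A) : aff_lieb x y = - aff_lieb y x.
Proof. by congr (_, _); rewrite /= ?oppr0 // opprB. Qed.

Fact aff_lieb_linearr (a : R) (x y z : aff A) :
  aff_lieb x (a *: y + z) = a *: aff_lieb x y + aff_lieb x z.
Proof.
by rewrite !(aff_liebC x) aff_lieb_linearl opprD scalerN.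
Qed.

Fact aff_lieb_jacobi (x y z : aff A) :
  aff_lieb x (aff_lieb y z) + aff_lieb y (aff_lieb z x) +
  aff_lieb z (aff_lieb x y) = 0.
Proof.
congr (_, _); rewrite /= ?addr0 // !amul0r !subr0 !amulBr !amulA.
rewrite (amulC y.1 x.1) (amulC z.1 x.1) (amulC z.1 y.1).
by rewrite [X in X + _ = _]addrC !subrKA subrr.
Qed.

HB.instance Definition _ := Vector_isLie.Build R (aff A)
  aff_lieb_linearl aff_lieb_linearr aff_liebxx aff_lieb_jacobi.

Definition aff_J_fun (u : aff A) : aff A := (- u.2, u.1).

Fact aff_J_is_linear : linear aff_J_fun.
Proof. by move=> a u v; congr (_, _); rewrite /= opprD scalerN. Qed.

HB.instance Definition _ :=
  GRing.isLinear.Build R _ _ _ aff_J_fun aff_J_is_linear.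

Definition aff_J : 'End(aff A) := linfun aff_J_fun.

Lemma aff_JE u : aff_J u = (- u.2, u.1).
Proof. by rewrite lfunE. Qed.

End Aff.

Section Tables.
Variables (R : fieldType) (n : nat).

(* Indices start at 1. *)
Definition e (i : nat) : 'rV[R]_n.+1 := \row_k (k.+1 == i)%:R.
Definition coordinate (x : 'rV[R]_n.+1) (i : nat) : R := x 0 (inord i.-1).

(* br i j v stands for [e_i, e_j] = v, and im i v for J e_i = v. *)
Definition br (i j : nat) (v : 'rV[R]_n.+1) : nat * nat * 'rV[R]_n.+1 :=
  (i, j, v).
Definition im (i : nat) (v : 'rV[R]_n.+1) : nat * 'rV[R]_n.+1 := (i, v).

(* The skew-symmetric bilinear map with the listed brackets; brackets of basis
   vectors listed in neither order are zero. *)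
Definition table_lieb (t : seq (nat * nat * 'rV[R]_n.+1)) (x y : 'rV[R]_n.+1) :
    'rV[R]_n.+1 :=
  \sum_(r <- t) (coordinate x r.1.1 * coordinate y r.1.2 -
                 coordinate x r.1.2 * coordinate y r.1.1) *: r.2.

Definition table_jacobi t : Prop :=
  forall x y z, table_lieb t x (table_lieb t y z) +
    table_lieb t y (table_lieb t z x) + table_lieb t z (table_lieb t x y) = 0.

Lemma table_liebxx t x : table_lieb t x x = 0.
Proof.
rewrite /table_lieb big1 // => r _.
by rewrite [X in X - _]mulrC subrr scale0r.
Qed.

Lemma table_lieb_linearl t (a : R) x y z :
  table_lieb t (a *: x + y) z = a *: table_lieb t x z + table_lieb t y z.
Proof.
rewrite /table_lieb scaler_sumr -big_split; apply: eq_bigr => r _ /=.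
by rewrite scalerA -scalerDl /coordinate !mxE; congr (_ *: _); ring.
Qed.

Lemma table_lieb_linearr t (a : R) x y z :
  table_lieb t x (a *: y + z) = a *: table_lieb t x y + table_lieb t x z.
Proof.
rewrite /table_lieb scaler_sumr -big_split; apply: eq_bigr => r _ /=.
by rewrite scalerA -scalerDl /coordinate !mxE; congr (_ *: _); ring.
Qed.

Definition table_alg t (tJ : table_jacobi t) : Type := 'rV[R]_n.+1.

HB.instance Definition _ t (tJ : table_jacobi t) :=
  Vector.copy (table_alg tJ) 'rV[R]_n.+1.

HB.instance Definition _ t (tJ : table_jacobi t) :=
  Vector_isLie.Build R (table_alg tJ) (table_lieb_linearl t)
    (table_lieb_linearr t) (table_liebxx t) tJ.

Definition table_map_fun (t : seq (nat * 'rV[R]_n.+1)) (x : 'rV[R]_n.+1) :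
    'rV[R]_n.+1 :=
  \sum_(r <- t) coordinate x r.1 *: r.2.

Fact table_map_is_linear t : linear (table_map_fun t).
Proof.
move=> a x y; rewrite /table_map_fun scaler_sumr -big_split.
by apply: eq_bigr => r _ /=; rewrite scalerA -scalerDl /coordinate !mxE.
Qed.

HB.instance Definition _ t :=
  GRing.isLinear.Build R _ _ _ (table_map_fun t) (table_map_is_linear t).

Definition table_map t : 'End('rV[R]_n.+1) := linfun (table_map_fun t).

Lemma table_mapE t x : table_map t x = \sum_(r <- t) coordinate x r.1 *: r.2.
Proof. by rewrite lfunE. Qed.

End Tables.

Arguments e {R n} i.

Section TableCoordinates.
Variables (R : fieldType) (n : nat).
Implicit Types x y : 'rV[R]_n.+1.

Lemma coordinateP x y :
  (forall i, (0 < i <= n.+1)%N -> coordinate x i = coordinate y i) -> x = y.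
Proof.
move=> xy; apply/rowP => k.
by have := xy k.+1 (ltn_ord k); rewrite /coordinate /= inord_val.
Qed.

Lemma coordinate0 i : coordinate (0 : 'rV[R]_n.+1) i = 0.
Proof. by rewrite /coordinate mxE. Qed.

Lemma coordinateD x y i :
  coordinate (x + y) i = coordinate x i + coordinate y i.
Proof. by rewrite /coordinate mxE. Qed.

Lemma coordinateN x i : coordinate (- x) i = - coordinate x i.
Proof. by rewrite /coordinate mxE. Qed.

Lemma coordinate_e i j : (0 < i <= n.+1)%N ->
  coordinate (e j : 'rV[R]_n.+1) i = (i == j)%:R.
Proof.
by case: i => // i /andP[_ i_le]; rewrite /coordinate mxE inordK.
Qed.

Lemma coordinate_lieb (t : seq (nat * nat * 'rV[R]_n.+1)) x y i :
  coordinate (table_lieb t x y) i =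
  foldr (fun r c => (coordinate x r.1.1 * coordinate y r.1.2 -
    coordinate x r.1.2 * coordinate y r.1.1) * coordinate r.2 i + c) 0 t.
Proof.
rewrite /table_lieb; elim: t => [|r t IH]; first by rewrite big_nil coordinate0.
by rewrite big_cons coordinateD IH /coordinate mxE.
Qed.

End TableCoordinates.

Ltac table_jacobi_tac :=
  let x := fresh in let y := fresh in let z := fresh in let i := fresh in
  move=> x y z; apply: coordinateP => i hi;
  rewrite coordinate0 !coordinateD !coordinate_lieb /= !coordinate_lieb /=;
  rewrite !(coordinateN, coordinate_e) //=;
  ring.

Section Models.
Variable R : fieldType.

Definition affR_table : seq (nat * nat * 'rV[R]_2) :=
  [:: br 1 2 (e 2)].

Fact affR_jacobi : table_jacobi affR_table.
Proof. table_jacobi_tac. Qed.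

Definition affR : lieAlgType R := table_alg affR_jacobi.

Definition affR_J : 'End(affR) :=
  table_map [:: im 1 (e 2); im 2 (- e 1)].

(* affR_ad is the semidirect product of aff(R) with R^2 through ad. *)
Definition affR_ad_table : seq (nat * nat * 'rV[R]_4) :=
  [:: br 1 2 (e 2); br 1 4 (e 4); br 2 3 (e 4)].

Fact affR_ad_jacobi : table_jacobi affR_ad_table.
Proof. table_jacobi_tac. Qed.

Definition affR_ad : lieAlgType R := table_alg affR_ad_jacobi.

Definition affR_ad_J : 'End(affR_ad) :=
  table_map [:: im 1 (e 2); im 2 (- e 1);
                im 3 (- e 4); im 4 (e 3)].

Definition affC_table : seq (nat * nat * 'rV[R]_4) :=
  [:: br 1 3 (e 3); br 1 4 (e 4); br 2 3 (e 4); br 2 4 (- e 3)].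

Fact affC_jacobi : table_jacobi affC_table.
Proof. table_jacobi_tac. Qed.

Definition affC : lieAlgType R := table_alg affC_jacobi.

Definition affC_J2 : 'End(affC) :=
  table_map [:: im 1 (e 3); im 2 (e 4);
                im 3 (- e 1); im 4 (- e 2)].

(* In s3 and s4, the vectors f_1, f_2, f_3 are e_4, e_5, e_6. *)
Definition s3_table : seq (nat * nat * 'rV[R]_6) :=
  [:: br 1 4 (e 4); br 1 5 (e 5); br 1 6 (e 6);
      br 2 4 (e 5); br 2 5 (e 6); br 3 4 (e 6)].

Fact s3_jacobi : table_jacobi s3_table.
Proof. table_jacobi_tac. Qed.

Definition s3 : lieAlgType R := table_alg s3_jacobi.

Definition s4_table : seq (nat * nat * 'rV[R]_6) :=
  [:: br 1 4 (e 4); br 1 5 (e 5); br 1 6 (e 6);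
      br 2 4 (e 5); br 3 4 (e 6)].

Fact s4_jacobi : table_jacobi s4_table.
Proof. table_jacobi_tac. Qed.

Definition s4 : lieAlgType R := table_alg s4_jacobi.

Definition ef_J_table : seq (nat * 'rV[R]_6) :=
  [:: im 1 (e 4); im 2 (e 5); im 3 (e 6);
      im 4 (- e 1); im 5 (- e 2); im 6 (- e 3)].

Definition s3_J : 'End(s3) := table_map ef_J_table.
Definition s4_J : 'End(s4) := table_map ef_J_table.

End Models.

(* Main.v *)
Require Import Defs.
From HB Require Import structures.
From mathcomp Require Import all_boot all_order all_algebra.
From mathcomp Require Import ring lra zify boolp reals.

Set Implicit Arguments.
Unset Strict Implicit.
Unset Printing Implicit Defensive.

Import Order.TTheory GRing.Theory Num.Theory.
Local Open Scope ring_scope.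

(** The eigenspaces of [J] on the complexification of [s] are abelian
    subalgebras, so Ito's argument makes [s' = [s, s]] abelian.  Hence
    [x y = [x, J y]] is a commutative associative product on [s'], and
    [s' :&: J s'] is central.  If [s = s' + J s'], then [s'] is spanned by the
    products of a complement of [s' :&: J s'] in [s']; counting symmetric
    products gives [\dim s' = 3], so that [s' :&: J s' = 0] and [(s, J)] is
    [aff(A)] with [A = s'] and [A^2 = A].  Such an [A] has a unit, and a unital
    [A] of dimension 3 is either generated by one element, in which case the
    roots of its cubic minimal polynomial decide between [R^3], [R x C],
    [R x R[t]/(t^2)] and [R[t]/(t^3)], or every element satisfies a quadratic
    equation and [A = R[t, u]/(t, u)^2].  These five algebras are pairwise
    non-isomorphic, and [aff(A)] determines [A].

    For the uniqueness on [aff(R) |x_ad R^2], the same product identifies the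
    derived algebra with the dual numbers for every abelian [J]. *)

(** * Bilinearity of Lie brackets and of commutative products *)

HB.instance Definition _ (R : fieldType) (g : lieAlgType R) (x : g) :=
  GRing.isLinear.Build R g g *:%R (lieb x) (fun a => lieb_linearr a x).

Fact amul_is_linear (R : fieldType) (A : comAssocAlgType R) (x : A) :
  linear (amul x).
Proof. by move=> a y z; rewrite amulC amul_linearl !(amulC _ x). Qed.

HB.instance Definition _ (R : fieldType) (A : comAssocAlgType R) (x : A) :=
  GRing.isLinear.Build R A A *:%R (amul x) (amul_is_linear x).

Section LieTheory.
Variables (R : fieldType) (g : lieAlgType R).
Implicit Types x y z : g.

Lemma liebDl x y z : lieb (x + y) z = lieb x z + lieb y z.
Proof. by rewrite -[x]scale1r lieb_linearl !scale1r. Qed.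

Lemma liebC x y : lieb x y = - lieb y x.
Proof.
have /eqP := liebxx (x + y).
by rewrite linearD /= !liebDl !liebxx add0r addr0 addrC addr_eq0 => /eqP.
Qed.

Lemma liebZl a x z : lieb (a *: x) z = a *: lieb x z.
Proof. by rewrite liebC linearZ /= -scalerN -liebC. Qed.

Lemma liebNl x z : lieb (- x) z = - lieb x z.
Proof. by rewrite -scaleN1r liebZl scaleN1r. Qed.

Lemma lieb0l z : lieb 0 z = 0.
Proof. by rewrite liebC raddf0 oppr0. Qed.

Lemma lieb_derived x y : lieb x y \in derived g.
Proof. exact: mem_prodspan (@lieb_linearl R g) (@lieb_linearr R g) x y. Qed.

Lemma jacobi_ad x y z : lieb (lieb x y) z = lieb x (lieb y z) - lieb y (lieb x z).
Proof.
have /eqP := lieb_jacobi x y z.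
rewrite [lieb z (lieb x y)]liebC subr_eq0 => /eqP <-.
by rewrite [lieb z x]liebC linearN.
Qed.

End LieTheory.

Section AlgTheory.
Variables (R : fieldType) (A : comAssocAlgType R).
Implicit Types x y z : A.

Lemma amulDl x y z : amul (x + y) z = amul x z + amul y z.
Proof. by rewrite ![amul _ z]amulC linearD. Qed.

Lemma amulZl a x z : amul (a *: x) z = a *: amul x z.
Proof. by rewrite ![amul _ z]amulC linearZ. Qed.

Lemma amul_square x y : amul x y \in alg_square A.
Proof. by apply: mem_prodspan => a u v w; rewrite ?amul_linearl ?linearP. Qed.

End AlgTheory.

(** * Commutativity of the derived algebra *)

Section DerivedAbelian.

(* Ito's argument that a Lie algebra which is the sum of two abelian
   subalgebras is metabelian; [a, a1, ...] and [b, b1, ...] stand for elements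
   of the two subalgebras. *)
Lemma ito_commutator (V : zmodType) (br : V -> V -> V)
    (brDl : forall x y z, br (x + y) z = br x z + br y z)
    (brDr : forall x y z, br x (y + z) = br x y + br x z)
    (brC : forall x y, br x y = - br y x)
    (brJ : forall x y z, br (br x y) z = br x (br y z) - br y (br x z))
    (a a' b b' a1 a2 b1 b2 : V) :
  br a b' = a1 + b1 -> br a' b = a2 + b2 ->
  br a a' = 0 -> br a a2 = 0 -> br a1 a2 = 0 -> br a1 a' = 0 ->
  br b b' = 0 -> br b1 b2 = 0 -> br b1 b = 0 -> br b2 b' = 0 ->
  br (br a b) (br a' b') = 0.
Proof.
move=> eab' ea'b aa' aa2 a1a2 a1a' bb' b1b2 b1b b2b'.
have br0l x : br 0 x = 0 by apply: (addIr (br 0 x)); rewrite -brDl !add0r.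
have br0r x : br x 0 = 0 by rewrite brC br0l oppr0.
have brNl x y : br (- x) y = - br x y.
  by apply: (addIr (br x y)); rewrite -brDl !addNr br0l.
have brNr x y : br x (- y) = - br x y by rewrite brC brNl -brC.
have -> : br (br a b) (br a' b') =
    br (br (br a b) a') b' + br a' (br (br a b) b').
  by rewrite [br (br (br a b) a') b']brJ subrK.
rewrite [br (br a b) a']brJ aa' br0r subr0 [br b a']brC ea'b brNr brDr aa2 add0r.
rewrite [br (br a b) b']brJ bb' br0r sub0r eab' brDr [br b b1]brC b1b oppr0 addr0.
rewrite -(brC a1) brNl brJ b2b' br0r sub0r opprK eab' brDr [br b2 b1]brC b1b2 oppr0.
have /eqP := brJ a1 a' b.
rewrite a1a' br0l eq_sym subr_eq0 => /eqP <-.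
by rewrite ea'b brDr a1a2 add0r addr0 brC addNr.
Qed.

Variables (R : numFieldType) (s : lieAlgType R) (J : 'End(s)).
Hypothesis abJ : abelian_complex_structure J.

Lemma acsK x : J (J x) = - x.
Proof. by have /lfunP/(_ x) := abJ.1; rewrite !lfunE /= lfunE. Qed.

Lemma acsC x y : lieb (J x) y = - lieb x (J y).
Proof. by rewrite -(abJ.2 x (J y)) acsK linearN opprK. Qed.

(** The bracket of the complexification of [s], with [(x, y)] standing for [x + i y]. *)
Definition complexified_lieb (u v : s * s) : s * s :=
  (lieb u.1 v.1 - lieb u.2 v.2, lieb u.1 v.2 + lieb u.2 v.1).

Lemma derived_abelian x y : x \in derived s -> y \in derived s -> lieb x y = 0.
Proof.
pose br := complexified_lieb.
have brDl u v w : br (u + v) w = br u w + br v w.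
  congr (_, _); rewrite /= !liebDl; first by rewrite opprD addrACA.
  by rewrite addrACA.
have brC u v : br u v = - br v u.
  congr (_, _); rewrite /= [lieb u.1 _]liebC [lieb u.2 _]liebC.
    by rewrite opprB opprK addrC.
  by rewrite -opprD addrC.
have brDr u v w : br u (v + w) = br u v + br u w.
  by rewrite brC brDl opprD -!brC.
have brJ u v w : br (br u v) w = br u (br v w) - br v (br u w).
  by congr (_, _); rewrite /= !liebDl !liebNl !jacobi_ad !linearD /= !linearN /=
    !opprK !addrA [LHS](ACl (1*5*7*3*2*8*6*4)%AC).
(* [(u, - J u)] and [(u, J u)] are [u - i J u] and [u + i J u], the eigenvectors of [J] for [i] and
   [- i]. *)
have Aab u v : br (u, - J u) (v, - J v) = 0.
  congr (_, _); rewrite /= !linearN /= !liebNl.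
    by rewrite opprK abJ.2 subrr.
  by rewrite acsC opprK addNr.
have Bab u v : br (u, J u) (v, J v) = 0.
  congr (_, _); rewrite /=; first by rewrite abJ.2 subrr.
  by rewrite acsC subrr.
have AB u v : br (u, - J u) (v, J v) = (lieb u v *+ 2, lieb u (J v) *+ 2).
  congr (_, _); rewrite /= liebNl; first by rewrite opprK abJ.2.
  by rewrite acsC opprK.
have key x1 y1 x2 y2 : lieb (lieb x1 y1) (lieb x2 y2) =
    lieb (lieb x1 (J y1)) (lieb x2 (J y2)).
  (* [p u v] and [q u v] are the real parts of the two eigencomponents of the mixed bracket. *)
  pose p u v := lieb u v + J (lieb u (J v)).
  pose q u v := lieb u v - J (lieb u (J v)).
  have pq u v : br (u, - J u) (v, J v) = (p u v, - J (p u v)) + (q u v, J (q u v)).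
    rewrite AB; congr (_, _); rewrite /=; first by rewrite addrACA subrr addr0.
    by rewrite /p /q linearB linearD /= !acsK opprD !opprK addrACA addNr add0r.
  have := ito_commutator brDl brDr brC brJ (pq x1 y2) (pq x2 y1)
    (Aab _ _) (Aab _ _) (Aab _ _) (Aab _ _)
    (Bab _ _) (Bab _ _) (Bab _ _) (Bab _ _).
  (* The real part of Ito's identity is the relation wanted in [s]. *)
  rewrite !AB => /(congr1 fst) /=.
  rewrite -!scaler_nat !liebZl !linearZ /= -!scalerDr => /eqP.
  by rewrite !scaler_eq0 !pnatr_eq0 /= subr_eq0 => /eqP.
(* Exchanging [x1] and [y1] changes the sign of the left side of [key] but not of its right side,
   because [[x, J y]] is symmetric. *)
have brk0 (x1 y1 x2 y2 : s) : lieb (lieb x1 y1) (lieb x2 y2) = 0.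
  have := key y1 x1 x2 y2; rewrite [lieb y1 (J x1)]liebC acsC opprK -key.
  rewrite [lieb y1 x1]liebC liebNl => /eqP; rewrite eq_sym -addr_eq0 -mulr2n.
  by rewrite -scaler_nat scaler_eq0 pnatr_eq0 => /eqP.
have ad0 u : (forall v w, lieb u (lieb v w) = 0) ->
    forall v, v \in derived s -> lieb u v = 0.
  move=> u0 v; have -> : lieb u v = linfun (lieb u) v by rewrite lfunE.
  move=> v_s; apply/eqP; rewrite -memv_ker; apply: subvP v v_s.
  apply: prodspan_min => a b.
  by rewrite memv_ker lfunE /= u0.
move=> x_s; apply: (ad0 x) => v w.
by rewrite liebC (ad0 _ (brk0 v w)) ?oppr0.
Qed.

End DerivedAbelian.

(** * Unitization, and the unit of a perfect commutative algebra *)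

Section Unit.
Variables (R : fieldType) (A : comAssocAlgType R).

(** [(a, x)] stands for [a + x], with a unit adjoined formally; determinants of matrices over [A]
    are taken in this commutative ring. *)
Definition unitization : Type := (R * A)%type.

HB.instance Definition _ := GRing.Zmodule.copy unitization (R * A)%type.

Definition unitization_mul (u v : unitization) : unitization :=
  (u.1 * v.1, u.1 *: v.2 + v.1 *: u.2 + amul u.2 v.2).

Fact unitization_mulC : commutative unitization_mul.
Proof.
move=> u v; congr (_, _); first exact: mulrC.
by rewrite [v.1 *: _ + _]addrC amulC.
Qed.

Fact unitization_mulA : associative unitization_mul.
Proof.
move=> u v w; congr (_, _); rewrite /= ?mulrA //.
rewrite !scalerDr !scalerA !amulDl !linearD /= !amulZl !linearZ /= amulA.
by rewrite ![w.1 * _]mulrC !addrA [LHS](ACl (1*2*4*6*3*5*7)%AC).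
Qed.

Fact unitization_mul1 : left_id (1, 0) unitization_mul.
Proof.
move=> [a x]; congr (_, _); rewrite /= ?mul1r //.
by rewrite scale1r scaler0 addr0 amulC linear0 addr0.
Qed.

Fact unitization_mulDl : left_distributive unitization_mul +%R.
Proof.
move=> u v w; congr (_, _); rewrite /= ?mulrDl // scalerDl scalerDr amulDl.
by rewrite !addrA [LHS](ACl (1*3*5*2*4*6)%AC).
Qed.

Fact unitization_1neq0 : (1, 0) != 0 :> unitization.
Proof. by rewrite xpair_eqE oner_eq0. Qed.

HB.instance Definition _ := GRing.Zmodule_isComNzRing.Build unitization
  unitization_mulA unitization_mulC unitization_mul1 unitization_mulDl
  unitization_1neq0.

Definition unitization_fst (u : unitization) : R := u.1.

Fact unitization_fst_is_zmod_morphism : zmod_morphism unitization_fst.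
Proof. by []. Qed.

Fact unitization_fst_is_monoid_morphism : monoid_morphism unitization_fst.
Proof. by []. Qed.

HB.instance Definition _ := GRing.isZmodMorphism.Build unitization R
  unitization_fst unitization_fst_is_zmod_morphism.
HB.instance Definition _ := GRing.isMonoidMorphism.Build unitization R
  unitization_fst unitization_fst_is_monoid_morphism.

Definition unitization_inj (x : A) : unitization := (0, x).

Fact unitization_inj_is_zmod_morphism : zmod_morphism unitization_inj.
Proof. by move=> x y; congr (_, _); rewrite /= subrr. Qed.

HB.instance Definition _ := GRing.isZmodMorphism.Build A unitization
  unitization_inj unitization_inj_is_zmod_morphism.

Lemma unitization_injM x y :
  unitization_inj (amul x y) = unitization_inj x * unitization_inj y.
Proof. by congr (_, _); rewrite /= ?mulr0 // !scale0r !add0r. Qed.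

(* Nakayama's determinant trick: a basis [a_i] of [A = A^2] satisfies
   [a_i = \sum_j r_ij a_j] with [r_ij] in [A], so [det (1 - r)], which has the
   form [1 - u] in the unitization, kills [A]. *)
Lemma perfect_alg_unit :
  alg_square A = fullv -> exists u : A, forall x, amul u x = x.
Proof.
move=> AA; pose n := \dim {:A}; pose a := vbasis {:A}.
pose comb (r : {ffun 'I_n -> A}) : A := \sum_k amul (r k) a`_k.
have comb_lin : linear comb.
  move=> c r r'; rewrite /comb scaler_sumr -big_split; apply: eq_bigr => k _ /=.
  by rewrite !ffunE amulDl amulZl.
pose combL := HB.pack_for {linear {ffun 'I_n -> A} -> A} comb
  (GRing.isLinear.Build R _ _ _ comb comb_lin).
(* Here [A = A^2] is used: expanding [z] in the basis exhibits the product of [y] and [z] as a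
   combination with coefficients in [A]. *)
have im_comb x : x \in limg (linfun combL).
  apply: subvP (memvf x); rewrite -AA; apply: prodspan_min => y z.
  apply/memv_imgP; exists [ffun k => coord a k z *: y]; first exact: memvf.
  rewrite lfunE /= /comb [in LHS](coord_vbasis (memvf z)) linear_sum.
  by apply: eq_bigr => k _; rewrite ffunE amulZl linearZ.
have /fin_all_exists[r rE] : forall i : 'I_n, exists r, a`_i = comb r.
  move=> i; have /memv_imgP[r _ ->] := im_comb a`_i.
  by exists r; rewrite lfunE.
pose M : 'M[unitization]_n :=
  \matrix_(i, j) ((i == j)%:R - unitization_inj (r i j)).
pose v : 'cV[unitization]_n := \col_j unitization_inj a`_j.
have Mv : M *m v = 0.
  apply/matrixP => i j; rewrite !mxE.
  under eq_bigr do rewrite !mxE mulrBl -unitization_injM.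
  rewrite sumrB -raddf_sum -[\sum_k _]/(comb (r i)) -rE (bigD1 i) //= eqxx mul1r.
  by rewrite big1 ?addr0 ?subrr // => k /negPf; rewrite eq_sym => ->; rewrite mul0r.
have detM (j : 'I_n) : \det M * unitization_inj a`_j = 0.
  have /(congr1 (mulmx (\adj M)))/matrixP/(_ j 0) := Mv.
  by rewrite mulmx0 mulmxA mul_adj_mx mul_scalar_mx !mxE.
have detM1 : (\det M).1 = 1.
  rewrite -[LHS]/(unitization_fst _) -det_map_mx.
  rewrite (_ : map_mx _ _ = 1%:M) ?det1 //.
  by apply/matrixP => i j; rewrite !mxE rmorphB /= rmorph_nat subr0.
(* Write [\det M = 1 + d] with [d] in [A]; then [(1 + d) a_j = 0] says that [- d] fixes every basis
   vector. *)
exists (- (\det M).2) => x; rewrite (coord_vbasis (memvf x)) linear_sum.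
apply: eq_bigr => i _; rewrite linearZ /=; congr (_ *: _).
have /(congr1 snd) /= := detM i.
rewrite detM1 scale0r addr0 scale1r => /eqP.
by rewrite addr_eq0 amulC [amul (- _) _]amulC linearN => /eqP <-.
Qed.

End Unit.

(** * Holomorphic isomorphisms and a criterion for being [aff(A)] *)

Section LinearBijections.
Variables (R : fieldType) (U V : vectType R).

Lemma lker0_bij (f : 'Hom(U, V)) :
  lker f == 0%VS -> \dim {:U} = \dim {:V} -> bijective f.
Proof.
move=> f0 dUV.
have fK : cancel f (f^-1)%VF by exact: lker0_lfunK.
have lf : limg f = fullv.
  by apply/eqP; rewrite eqEdim subvf limg_dim_eq ?dUV //= (eqP f0) capv0.
by exists (f^-1)%VF => // y; apply: limg_lfunVK; rewrite lf memvf.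
Qed.

Lemma bij_lker0 (f : 'Hom(U, V)) : bijective f -> lker f == 0%VS.
Proof. by move=> [g gK _]; apply/lker0P/(can_inj gK). Qed.

End LinearBijections.

Section HolIso.
Variables (R : fieldType) (g1 g2 g3 : lieAlgType R).
Variables (J1 : 'End(g1)) (J2 : 'End(g2)) (J3 : 'End(g3)).

Lemma hol_isomorphic_trans :
  hol_isomorphic J1 J2 -> hol_isomorphic J2 J3 -> hol_isomorphic J1 J3.
Proof.
move=> [f [bf fL] fJ] [h [bh hL] hJ]; exists (h \o f)%VF; last first.
  by rewrite comp_lfunA hJ -comp_lfunA fJ comp_lfunA.
split=> [|x y]; last by rewrite !comp_lfunE fL hL.
by apply: (eq_bij (bij_comp bh bf)) => x; rewrite comp_lfunE.
Qed.

Lemma hol_isomorphic_sym : hol_isomorphic J1 J2 -> hol_isomorphic J2 J1.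
Proof.
move=> [f [bf fL] fJ].
have fK : cancel f (f^-1)%VF by apply/lker0_lfunK/bij_lker0.
have Kf : cancel (f^-1)%VF f by apply/(bij_can_sym bf).
exists (f^-1)%VF.
  by split=> [|x y]; [exists f | apply: (can_inj fK); rewrite fL !Kf].
apply/lfunP => x; rewrite !comp_lfunE; apply: (can_inj fK); rewrite Kf.
by have /lfunP/(_ (f^-1%VF x)) := fJ; rewrite !comp_lfunE Kf => <-.
Qed.

End HolIso.

(* The isomorphism is [(x, y) |-> f y - J (f x)]; it is injective since
   bracketing its value with [f u] recovers [x]. *)
Lemma hol_isomorphic_aff (R : numFieldType) (A : comAssocAlgType R) (u : A)
    (g : lieAlgType R) (J : 'End(g)) (f : 'Hom(A, g)) :
    (forall x, amul u x = x) ->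
    \dim {:g} = (\dim {:A} * 2)%N -> abelian_complex_structure J ->
    lker f == 0%VS -> (forall x y, lieb (f x) (f y) = 0) ->
    (forall x y, lieb (f x) (J (f y)) = f (amul x y)) ->
  hol_isomorphic (aff_J A) J.
Proof.
move=> u1 dimg abJ f0 ff0 fM.
(* The standard structure sends [(0, x)] to [(- x, 0)], so compatibility with [J] forces the image
   of [(x, 0)] to be [- J (f x)]. *)
pose h (v : aff A) : g := f v.2 - J (f v.1).
have hlin : linear h.
  move=> a v w; rewrite /h -[(a *: v + w).1]/(a *: v.1 + w.1).
  rewrite -[(a *: v + w).2]/(a *: v.2 + w.2) !linearP /=.
  by rewrite scalerDr addrACA.
pose hL := HB.pack_for {linear aff A -> g} h
  (GRing.isLinear.Build R (aff A) g _ h hlin).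
have hE v : linfun hL v = f v.2 - J (f v.1) by rewrite lfunE.
exists (linfun hL); last first.
  apply/lfunP => v; rewrite !comp_lfunE !hE aff_JE /= linearB /= (acsK abJ).
  by rewrite opprK addrC !linearN /= opprK.
split; last first.
  move=> v w; rewrite !hE /= linear0 linear0 subr0 linearB /= -!fM.
  rewrite linearB /= !liebDl !liebNl abJ.2 !ff0 oppr0 addr0 sub0r acsC // opprK.
  by rewrite [lieb (f v.2) _]liebC acsC // opprK.
apply: lker0_bij; last by rewrite dimg muln2 -addnn !dimvf.
apply/lker0P/raddf_inj => v hv0.
have v0 : f v.2 - J (f v.1) = 0 by rewrite -hE.
have f_eq0 x : f x = 0 -> x = 0.
  by move=> fx0; apply: (lker0P f0); rewrite fx0 linear0.
have v1 : v.1 = 0.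
  have := congr1 (lieb (f u)) v0; rewrite linearB /= ff0 fM u1 sub0r linear0.
  by move/eqP; rewrite oppr_eq0 => /eqP/f_eq0.
have v2 : v.2 = 0 by apply: f_eq0; move: v0; rewrite v1 !linear0 addr0.
by case: v v1 v2 {v0 hv0} => [? ?] /= -> ->.
Qed.

Lemma dim_le2_span (R : fieldType) (V : vectType R) (U : {vspace V}) :
  (\dim U <= 2)%N -> exists x y,
    [/\ x \in U, y \in U & forall z, z \in U -> exists a b, z = a *: x + b *: y].
Proof.
move=> dU; have Ub (i : nat) : (vbasis U)`_i \in U.
  case: (ltnP i (\dim U)) => iU; last by rewrite nth_default ?mem0v // size_tuple.
  by apply/vbasis_mem/mem_nth; rewrite size_tuple.
exists (vbasis U)`_0, (vbasis U)`_1; split=> // z /coord_vbasis ->.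
move: (vbasis U) dU; case: (\dim U) => [|[|[|//]]] b _.
- by exists 0, 0; rewrite !scale0r addr0 big_ord0.
- by exists (coord b ord0 z), 0; rewrite scale0r addr0 big_ord1.
- exists (coord b ord0 z), (coord b (lift ord0 ord0) z).
  by rewrite big_ord_recl big_ord1.
Qed.

(** * The associative product on the derived algebra, and its dimension *)

Section NonProper.
Variables (R : numFieldType) (s : lieAlgType R) (J : 'End(s)).
Hypothesis abJ : abelian_complex_structure J.

(** The type is indexed by the proof that [J] is abelian because the product put on it depends on
    [J] and its laws on that proof. *)
Definition derived_alg (_ : abelian_complex_structure J) : Type :=
  subvs_of (derived s).

HB.instance Definition _ :=
  Vector.copy (derived_alg abJ) (subvs_of (derived s)).

Definition derived_mul (x y : derived_alg abJ) : derived_alg abJ :=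
  vsproj (derived s) (lieb (vsval x) (J (vsval y))).

Lemma derived_mulE x y :
  vsval (derived_mul x y) = lieb (vsval x) (J (vsval y)).
Proof. by rewrite vsprojK ?lieb_derived. Qed.

Fact derived_mul_linearl a x y z :
  derived_mul (a *: x + y) z = a *: derived_mul x z + derived_mul y z.
Proof.
by apply: subvs_inj; rewrite linearP /= !derived_mulE linearP /= lieb_linearl.
Qed.

Fact derived_mulC : commutative derived_mul.
Proof.
move=> x y; apply: subvs_inj; rewrite !derived_mulE liebC acsC //.
by rewrite opprK.
Qed.

(* The operators [ad (J x)], [x] in [s'], commute on the abelian ideal [s']. *)
Fact derived_mulA : associative derived_mul.
Proof.
move=> x y z; rewrite [derived_mul y z]derived_mulC [RHS]derived_mulC.
have mulE (u v : derived_alg abJ) :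
    vsval (derived_mul u v) = - lieb (J (vsval u)) (vsval v).
  by rewrite derived_mulE acsC // opprK.
apply: subvs_inj; rewrite !mulE !linearN /= !opprK; apply/eqP.
rewrite -subr_eq0 -jacobi_ad abJ.2.
by rewrite [X in lieb X _](derived_abelian abJ) ?subvsP // lieb0l.
Qed.

HB.instance Definition _ := Vector_isComAssoc.Build R (derived_alg abJ)
  derived_mul_linearl derived_mulC derived_mulA.

Hypothesis npJ : non_proper J.

Lemma non_proper_decomp x : exists x1 x2 : derived_alg abJ,
  x = vsval x1 + J (vsval x2).
Proof.
have := memvf x; rewrite -npJ => /memv_addP[y yD [_ /memv_imgP[z zD ->] ->]].
by exists (vsproj _ y), (vsproj _ z); rewrite !vsprojK.
Qed.

(** Both [s'] and [J s'] are abelian, so only the mixed terms of the bracket survive. *)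
Lemma non_proper_lieb x y : exists x1 x2 y1 y2 : derived_alg abJ,
  lieb x y = vsval (amul x1 y2 - amul y1 x2).
Proof.
have [x1 [x2 ->]] := non_proper_decomp x.
have [y1 [y2 ->]] := non_proper_decomp y.
exists x1, x2, y1, y2; rewrite linearB /= !derived_mulE.
have ab0 (u v : derived_alg abJ) : lieb (vsval u) (vsval v) = 0.
  by rewrite (derived_abelian abJ) ?subvsP.
rewrite linearD /= !liebDl abJ.2 !ab0 addr0 add0r.
by rewrite [lieb (J _) _]liebC addrC.
Qed.

(** Brackets span [s'], and each one is a difference of two products of elements of [s']. *)
Lemma derived_alg_perfect :
  alg_square (derived_alg abJ : comAssocAlgType R) = fullv.
Proof.
apply/eqP; rewrite eqEsubv subvf; apply/subvP => x _.
pose A : comAssocAlgType R := derived_alg abJ.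
have /memv_imgP[y yA xy] : vsval x \in (linfun vsval @: alg_square A)%VS.
  apply: subvP (subvsP x); apply: prodspan_min => y z.
  have [y1 [y2 [z1 [z2 ->]]]] := non_proper_lieb y z.
  apply/memv_imgP; exists (amul y1 z2 - amul z1 y2); last by rewrite lfunE.
  by apply: rpredB; apply: (amul_square (A := derived_alg abJ)).
by move: xy; rewrite lfunE => /val_inj ->.
Qed.

Lemma dim_J_img (U : {vspace s}) : \dim (J @: U)%VS = \dim U.
Proof.
apply: limg_dim_eq; apply/eqP; rewrite -subv0; apply/subvP => x.
rewrite memv_cap memv_ker => /andP[_ /eqP Jx0].
by rewrite memv0 -oppr_eq0 -(acsK abJ) Jx0 linear0.
Qed.

(* With [d = \dim s' > 3], the central subspace [W = s' :&: J s'] has dimension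
   [2 d - 6], so its complement in [s'] has dimension [6 - d <= 2] and only
   three symmetric products. *)
Lemma dim_derived_le3 : \dim {:s} = 6%N -> (\dim (derived s) <= 3)%N.
Proof.
move=> d6; set D := derived s; rewrite leqNgt; apply/negP => D_gt3.
pose W := (D :&: J @: D)%VS; pose Q := (D :\: J @: D)%VS.
have dQ : (\dim Q <= 2)%N.
  have := dimv_sum_cap D (J @: D)%VS; rewrite npJ d6 dim_J_img.
  have := dimv_cap_compl D (J @: D)%VS; rewrite -/Q.
  lia.
(* For [w = J v] with [v] in [s'], [[J v, J x] = [v, x] = 0]. *)
have W0 w x : w \in W -> x \in D -> lieb w (J x) = 0.
  rewrite memv_cap => /andP[_ /memv_imgP[v vD ->]] xD.
  by rewrite abJ.2 (derived_abelian abJ).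
have symJ x y : lieb x (J y) = lieb y (J x) by rewrite liebC acsC // opprK.
have [q1 [q2 [q1Q q2Q Qq]]] := dim_le2_span dQ.
have QD : (Q <= D)%VS by exact: diffvSl.
have decomp x : x \in D -> exists a b w, w \in W /\ x = a *: q1 + b *: q2 + w.
  rewrite -(addv_diff_cap D (J @: D)%VS) => /memv_addP[q /Qq[a [b ->]] [w wW ->]].
  by exists a, b, w.
pose B := [:: lieb q1 (J q1); lieb q1 (J q2); lieb q2 (J q2)].
suff /dimvS : (D <= <<B>>)%VS by have := dim_span B; rewrite /=; lia.
have q1D := subvP QD _ q1Q; have q2D := subvP QD _ q2Q.
have prodB x y : x \in D -> y \in D -> lieb x (J y) \in <<B>>%VS.
  move=> xD /decomp[a' [b' [w' [w'W ->]]]].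
  rewrite !linearD /= [lieb x (J w')]symJ (W0 w') // addr0 !linearZ /=.
  move: xD => /decomp[a [b [w [wW ->]]]].
  rewrite !liebDl ![lieb w _]W0 // !addr0 !liebZl [lieb q2 (J q1)]symJ.
  by rewrite !(rpredD, rpredZ) // memv_span // !inE eqxx ?orbT.
apply: prodspan_min => x y.
have [x1 [x2 [y1 [y2 ->]]]] := non_proper_lieb x y.
by rewrite linearB /= !derived_mulE rpredB // prodB ?subvsP.
Qed.

(** The lower bound holds because [s] is the sum of [s'] and [J s'], which have the same
    dimension. *)
Lemma dim_derived : \dim {:s} = 6%N -> \dim (derived s) = 3%N.
Proof.
move=> d6; apply/eqP; rewrite eqn_leq dim_derived_le3 //=.
have := dimv_sum_cap (derived s) (J @: derived s)%VS; rewrite npJ d6 dim_J_img.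
lia.
Qed.

End NonProper.

Section PartOne.
Variables (R : numFieldType) (s : lieAlgType R) (J : 'End(s)).
Hypotheses (abJ : abelian_complex_structure J) (npJ : non_proper J).
Hypothesis dim6 : \dim {:s} = 6%N.

Lemma dim_derived_alg : \dim {:derived_alg abJ} = 3%N.
Proof. by rewrite dimvf -(dim_derived abJ npJ dim6). Qed.

(** The criterion applies to the inclusion of [s'] in [s], which carries the product to [[x, J y]]
    by construction. *)
Lemma hol_isomorphic_derived_alg :
  hol_isomorphic (aff_J (derived_alg abJ : comAssocAlgType R)) J.
Proof.
have [u u1] := perfect_alg_unit (derived_alg_perfect abJ npJ).
pose f : 'Hom(derived_alg abJ, s) := linfun vsval.
apply: (hol_isomorphic_aff (f := f) u1) => //.
- by rewrite dim_derived_alg dim6.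
- by apply/lker0P => x y; rewrite !lfunE => /subvs_inj.
- by move=> x y; rewrite !lfunE (derived_abelian abJ) ?subvsP.
- by move=> x y; rewrite !lfunE [RHS]derived_mulE.
Qed.

End PartOne.

(** Between algebras of equal dimension, the only case needed for the classification, such a map is
    an isomorphism. *)
Definition alg_embeds (R : fieldType) (A B : comAssocAlgType R) : Prop :=
  exists2 f : 'Hom(A, B), lker f == 0%VS &
    forall x y, f (amul x y) = amul (f x) (f y).

(** * Isomorphisms of [aff(A)] and [aff(B)] against those of [A] and [B] *)

Section AffFunctor.
Variables (R : numFieldType) (A B : comAssocAlgType R) (u : A).
Hypothesis u1 : forall x, amul u x = x.

Lemma aff_J_abelian (C : comAssocAlgType R) :
  abelian_complex_structure (aff_J C).
Proof.
split=> [|x y].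
  by apply/lfunP => -[x y]; rewrite comp_lfunE opp_lfunE id_lfunE !aff_JE.
rewrite !aff_JE; congr (_, _); rewrite /= ![amul (- _) _]amulC !linearN /=.
by rewrite opprK addrC.
Qed.

(** The criterion applies to [x |-> (0, f x)], since [[(0, x), J (0, y)] = (0, x y)]. *)
Lemma hol_isomorphic_of_embeds :
  \dim {:A} = \dim {:B} -> alg_embeds A B -> hol_isomorphic (aff_J A) (aff_J B).
Proof.
move=> dAB [f f0 fM]; pose h (x : A) : aff B := (0, f x).
have hlin : linear h.
  by move=> a x y; congr (_, _); rewrite /= ?scaler0 ?addr0 // linearP.
pose hL := HB.pack_for {linear A -> aff B} h
  (GRing.isLinear.Build R A (aff B) _ h hlin).
apply: (hol_isomorphic_aff (f := linfun hL) u1).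
- by rewrite dAB muln2 -addnn !dimvf.
- exact: aff_J_abelian.
- by apply/lker0P => x y; rewrite !lfunE => -[/(lker0P f0)].
- by move=> x y; rewrite !lfunE; congr (_, _); rewrite /= !(amulC 0) !linear0 addr0.
- move=> x y; rewrite !lfunE; congr (_, _).
  by rewrite /= linear0 sub0r [amul (- _) _]amulC linearN opprK fM.
Qed.

(** As [(0, x) = [(u, 0), (0, x)]], [alpha] maps the second summand into the second summand; as it
    commutes with the complex structures, it acts by the same map [h] on the first. The bracket
    between the summands encodes the product, so [h] is multiplicative. *)
Lemma hol_isomorphic_embeds :
  hol_isomorphic (aff_J A) (aff_J B) -> alg_embeds A B.
Proof.
move=> [alpha [bij_a aL] aJ].
have aJE v : alpha (aff_J A v) = aff_J B (alpha v).
  by have /lfunP/(_ v) := aJ; rewrite !comp_lfunE.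
pose h (x : A) : B := (alpha (0, x)).2.
have hlin : linear h.
  move=> a x y; rewrite /h.
  have -> : ((0, a *: x + y) : aff A) = a *: ((0, x) : aff A) + (0, y).
    by congr (_, _); rewrite /= scaler0 addr0.
  by rewrite linearP.
pose hL := HB.pack_for {linear A -> B} h (GRing.isLinear.Build R A B _ h hlin).
pose in1 (x : A) : aff A := (x, 0); pose in2 (x : A) : aff A := (0, x).
have in12 x y : lieb (in1 x) (in2 y) = in2 (amul x y).
  by congr (_, _); rewrite /= linear0 subr0.
have a2E x : alpha (in2 x) = (0, h x).
  by rewrite -[x in LHS]u1 -in12 aL /h -/(in2 x) -[x in RHS]u1 -in12 aL.
have a1E x : alpha (in1 x) = (h x, 0).
  have -> : in1 x = - aff_J A (in2 x).
    by rewrite aff_JE; congr (_, _); rewrite /= ?opprK ?oppr0.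
  rewrite linearN /= aJE a2E aff_JE.
  by congr (_, _); rewrite /= ?opprK ?oppr0.
exists (linfun hL) => [|x y].
  apply/lker0P => x y; rewrite !lfunE /= => hxy.
  have /(bij_inj bij_a)[] // : alpha (in2 x) = alpha (in2 y).
  by rewrite !a2E hxy.
rewrite !lfunE /= /h -/(in2 _) -in12 aL a1E a2E /=.
by rewrite linear0 subr0.
Qed.

End AffFunctor.

(** * Algebras given by multiplication tables, and the model algebras *)

Section AlgTables.
Variables (R : fieldType) (n : nat).
Implicit Types (t : seq (nat * nat * 'rV[R]_n.+1)).

(* The bilinear map with the listed products [e_i e_j = v]; unlike the brackets
   of [table_lieb], products of distinct basis vectors are listed twice. *)
Definition table_mul t (x y : 'rV[R]_n.+1) : 'rV[R]_n.+1 :=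
  \sum_(r <- t) (coordinate x r.1.1 * coordinate y r.1.2) *: r.2.

Lemma table_mul_linearl t (a : R) x y z :
  table_mul t (a *: x + y) z = a *: table_mul t x z + table_mul t y z.
Proof.
rewrite /table_mul scaler_sumr -big_split; apply: eq_bigr => r _ /=.
by rewrite scalerA -scalerDl /coordinate !mxE mulrDl mulrA.
Qed.

Lemma coordinate_mul t x y i :
  coordinate (table_mul t x y) i =
  foldr (fun r c => coordinate x r.1.1 * coordinate y r.1.2 *
    coordinate r.2 i + c) 0 t.
Proof.
rewrite /table_mul; elim: t => [|r t IH]; first by rewrite big_nil coordinate0.
by rewrite big_cons coordinateD IH /coordinate mxE.
Qed.

Lemma coordinateZ (a : R) (x : 'rV[R]_n.+1) i :
  coordinate (a *: x) i = a * coordinate x i.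
Proof. by rewrite /coordinate mxE. Qed.

Definition table_com_assoc t : Prop :=
  commutative (table_mul t) /\ associative (table_mul t).

Definition alg_of_table t (tP : table_com_assoc t) : Type := 'rV[R]_n.+1.

HB.instance Definition _ t (tP : table_com_assoc t) :=
  Vector.copy (alg_of_table tP) 'rV[R]_n.+1.

HB.instance Definition _ t (tP : table_com_assoc t) :=
  Vector_isComAssoc.Build R (alg_of_table tP) (table_mul_linearl t) tP.1 tP.2.

Definition row_hom_fun (V : vectType R) (b : seq V) (x : 'rV[R]_n.+1) : V :=
  \sum_(i < n.+1) x 0 i *: b`_i.

Fact row_hom_is_linear V b : linear (@row_hom_fun V b).
Proof.
move=> a x y; rewrite /row_hom_fun scaler_sumr -big_split.
by apply: eq_bigr => i _ /=; rewrite scalerA -scalerDl !mxE.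
Qed.

HB.instance Definition _ V b :=
  GRing.isLinear.Build R _ _ _ (@row_hom_fun V b) (@row_hom_is_linear V b).

Definition row_hom (V : vectType R) (b : seq V) : 'Hom('rV[R]_n.+1, V) :=
  linfun (row_hom_fun b).

Lemma row_homE (V : vectType R) (b : seq V) x :
  row_hom b x = \sum_(i < n.+1) coordinate x i.+1 *: b`_i.
Proof.
by rewrite lfunE; apply: eq_bigr => i _; rewrite /coordinate /= inord_val.
Qed.

End AlgTables.

Ltac table_com_assoc_tac :=
  split; [let x := fresh in let y := fresh in move=> x y |
          let x := fresh in let y := fresh in let z := fresh in move=> x y z];
  apply: coordinateP => i hi; rewrite !coordinate_mul /= ?coordinate_mul /=;
  rewrite ?(coordinateZ, coordinate_e) //=; ring.

Section AlgModels.
Variable R : fieldType.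

Fact base_table_com_assoc : table_com_assoc [:: br 1 1 (e 1 : 'rV[R]_1)].
Proof. table_com_assoc_tac. Qed.

Definition base_alg : comAssocAlgType R := alg_of_table base_table_com_assoc.

Fact dual_table_com_assoc : table_com_assoc
  [:: br 1 1 (e 1 : 'rV[R]_2); br 1 2 (e 2); br 2 1 (e 2)].
Proof. table_com_assoc_tac. Qed.

Definition dual_alg : comAssocAlgType R := alg_of_table dual_table_com_assoc.

Fact quad_table_com_assoc (d : R) : table_com_assoc
  [:: br 1 1 (e 1 : 'rV[R]_3); br 2 2 (e 2); br 2 3 (e 3); br 3 2 (e 3);
      br 3 3 (d *: e 2)].
Proof. table_com_assoc_tac. Qed.

(* [R x R[t]/(t^2 - d)] *)
Definition quad_alg d : comAssocAlgType R := alg_of_table (quad_table_com_assoc d).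

Fact local_table_com_assoc (p : R) : table_com_assoc
  [:: br 1 1 (e 1 : 'rV[R]_3); br 1 2 (e 2); br 2 1 (e 2); br 1 3 (e 3);
      br 3 1 (e 3); br 2 2 (p *: e 3)].
Proof. table_com_assoc_tac. Qed.

(* [R[t]/(t^3)] for [p = 1] and [R[t, u]/(t, u)^2] for [p = 0]. *)
Definition local_alg p : comAssocAlgType R := alg_of_table (local_table_com_assoc p).

End AlgModels.

Section TableMaps.
Variables (R : fieldType) (n : nat).

Lemma coordinate_map (t : seq (nat * 'rV[R]_n.+1)) x i :
  coordinate (table_map t x) i =
  foldr (fun r c => coordinate x r.1 * coordinate r.2 i + c) 0 t.
Proof.
rewrite table_mapE; elim: t => [|r t IH]; first by rewrite big_nil coordinate0.
by rewrite big_cons coordinateD IH /coordinate mxE.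
Qed.

End TableMaps.

Definition coordE := (coordinate0, coordinateD, coordinateN, coordinateZ).

Ltac coordinate_simp :=
  rewrite ?(coordinate_lieb, coordinate_map, coordinate_mul) /=;
  rewrite ?(coordinate_lieb, coordinate_map, coordinate_mul) /=;
  rewrite ?(coordE, coordinate_lieb, coordinate_map, coordinate_mul) /=;
  rewrite ?(coordE, coordinate_e) //=.

Ltac index_cases i :=
  case: i => [|[|[|[|[|[|[|i]]]]]]] // _.

Lemma row_hom1E (R : fieldType) (V : vectType R) (a : V) (x : 'rV[R]_1) :
  row_hom 0 [:: a] x = coordinate x 1 *: a.
Proof. by rewrite row_homE big_ord1. Qed.

Lemma row_hom2E (R : fieldType) (V : vectType R) (a b : V) (x : 'rV[R]_2) :
  row_hom 1 [:: a; b] x = coordinate x 1 *: a + coordinate x 2 *: b.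
Proof. by rewrite row_homE !big_ord_recl big_ord0 /= addr0. Qed.

Lemma row_hom3E (R : fieldType) (V : vectType R) (a b c : V) (x : 'rV[R]_3) :
  row_hom 2 [:: a; b; c] x =
  coordinate x 1 *: a + coordinate x 2 *: b + coordinate x 3 *: c.
Proof. by rewrite row_homE !big_ord_recl big_ord0 /= addr0 addrA. Qed.

Section Units.
Variable R : fieldType.

Lemma base_alg_unit (x : base_alg R) : @amul R (base_alg R) (e 1) x = x.
Proof. apply: coordinateP => i; index_cases i; coordinate_simp; ring. Qed.

Lemma dual_alg_unit (x : dual_alg R) : @amul R (dual_alg R) (e 1) x = x.
Proof. apply: coordinateP => i; index_cases i; coordinate_simp; ring. Qed.

Lemma local_alg_unit p (x : local_alg p) : @amul R (local_alg p) (e 1) x = x.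
Proof. apply: coordinateP => i; index_cases i; coordinate_simp; ring. Qed.

Lemma quad_alg_unit (d : R) (x : quad_alg d) :
  @amul R (quad_alg d) (e 1 + e 2) x = x.
Proof. apply: coordinateP => i; index_cases i; coordinate_simp; ring. Qed.

End Units.

(** * The model complex structures are abelian *)

Section Abelian.
Variable R : fieldType.

Ltac abelian_tac :=
  let x := fresh in let y := fresh in let i := fresh in
  let hi := fresh in split;
  [apply/lfunP => x; rewrite comp_lfunE opp_lfunE id_lfunE;
   apply: coordinateP => i; index_cases i; coordinate_simp; ring
  |move=> x y; apply: coordinateP => i hi; coordinate_simp; ring].

Lemma affR_J_abelian : abelian_complex_structure (affR_J R).
Proof. abelian_tac. Qed.

Lemma affR_ad_J_abelian : abelian_complex_structure (affR_ad_J R).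
Proof. abelian_tac. Qed.

Lemma affC_J2_abelian : abelian_complex_structure (affC_J2 R).
Proof. abelian_tac. Qed.

Lemma s3_J_abelian : abelian_complex_structure (s3_J R).
Proof. abelian_tac. Qed.

Lemma s4_J_abelian : abelian_complex_structure (s4_J R).
Proof. abelian_tac. Qed.

Lemma prod_J_abelian (g1 g2 : lieAlgType R) (J1 : 'End(g1)) (J2 : 'End(g2)) :
  abelian_complex_structure J1 -> abelian_complex_structure J2 ->
  abelian_complex_structure (prod_J J1 J2).
Proof.
move=> [J1K ab1] [J2K ab2]; split=> [|x y]; last first.
  by rewrite !prod_JE; congr (_, _); rewrite /= ?ab1 ?ab2.
apply/lfunP => -[x y]; rewrite comp_lfunE opp_lfunE id_lfunE !prod_JE.
congr (_, _) => /=.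
  by have /lfunP/(_ x) := J1K; rewrite comp_lfunE opp_lfunE id_lfunE.
by have /lfunP/(_ y) := J2K; rewrite comp_lfunE opp_lfunE id_lfunE.
Qed.

End Abelian.

(** * The five model Lie algebras as [aff(A)] *)

Section ModelsAff.
Variable R : realFieldType.


Local Notation coord j := (fun v : 'rV[R]_(_.+1) => coordinate v j).

(** Since [[f_i, J f_j] = [e_j, f_i]], the vectors [f_1, f_2, f_3] multiply as [1, t, t^2]. The next
    four lemmas likewise map the algebra onto the derived algebra. *)
Lemma s3_aff : hol_isomorphic (aff_J (local_alg (1 : R))) (s3_J R).
Proof.
pose f : 'Hom(local_alg (1 : R), s3 R) := row_hom 2 [:: e 4; e 5; e 6].
have fE x : f x =
    coordinate x 1 *: e 4 + coordinate x 2 *: e 5 + coordinate x 3 *: e 6.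
  exact: row_hom3E.
apply: (hol_isomorphic_aff (f := f) (@local_alg_unit _ _)).
- by rewrite !dimvf.
- exact: s3_J_abelian.
- apply/lker0P => x y; rewrite !fE => xy.
  move: (congr1 (coord 4) xy) (congr1 (coord 5) xy) (congr1 (coord 6) xy).
  coordinate_simp; rewrite !(mulr1, mulr0, addr0, add0r) => *.
  by apply: coordinateP => i; index_cases i.
- by move=> x y; rewrite !fE; apply: coordinateP => i hi; coordinate_simp; ring.
- by move=> x y; rewrite !fE; apply: coordinateP => i hi; coordinate_simp; ring.
Qed.

Lemma s4_aff : hol_isomorphic (aff_J (local_alg (0 : R))) (s4_J R).
Proof.
pose f : 'Hom(local_alg (0 : R), s4 R) := row_hom 2 [:: e 4; e 5; e 6].
have fE x : f x =
    coordinate x 1 *: e 4 + coordinate x 2 *: e 5 + coordinate x 3 *: e 6.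
  exact: row_hom3E.
apply: (hol_isomorphic_aff (f := f) (@local_alg_unit _ _)).
- by rewrite !dimvf.
- exact: s4_J_abelian.
- apply/lker0P => x y; rewrite !fE => xy.
  move: (congr1 (coord 4) xy) (congr1 (coord 5) xy) (congr1 (coord 6) xy).
  coordinate_simp; rewrite !(mulr1, mulr0, addr0, add0r) => *.
  by apply: coordinateP => i; index_cases i.
- by move=> x y; rewrite !fE; apply: coordinateP => i hi; coordinate_simp; ring.
- by move=> x y; rewrite !fE; apply: coordinateP => i hi; coordinate_simp; ring.
Qed.

Lemma affR_affC_aff :
  hol_isomorphic (aff_J (quad_alg (-1 : R))) (prod_J (affR_J R) (affC_J2 R)).
Proof.
pose f : 'Hom(quad_alg (-1 : R), (affR R * affC R)%type) :=
  row_hom 2 [:: (e 2, 0); (0, e 3); (0, e 4)].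
have fE x : f x =
    (coordinate x 1 *: e 2, coordinate x 2 *: e 3 + coordinate x 3 *: e 4).
  by rewrite [LHS]row_hom3E; congr (_, _) => /=; rewrite !scaler0 ?addr0 ?add0r.
apply: (hol_isomorphic_aff (f := f) (@quad_alg_unit _ _)).
- by rewrite !dimvf.
- exact: prod_J_abelian (affR_J_abelian R) (affC_J2_abelian R).
- apply/lker0P => x y; rewrite !fE => -[xy1 xy2].
  move: (congr1 (coord 2) xy1) (congr1 (coord 3) xy2) (congr1 (coord 4) xy2).
  coordinate_simp; rewrite !(mulr1, mulr0, addr0, add0r) => *.
  by apply: coordinateP => i; index_cases i.
- by move=> x y; rewrite !fE; congr (_, _); apply: coordinateP => i hi;
    coordinate_simp; ring.
- by move=> x y; rewrite !fE prod_JE; congr (_, _); apply: coordinateP => i hi;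
    coordinate_simp; ring.
Qed.

Lemma affR_affR_ad_aff :
  hol_isomorphic (aff_J (quad_alg (0 : R))) (prod_J (affR_J R) (affR_ad_J R)).
Proof.
pose f : 'Hom(quad_alg (0 : R), (affR R * affR_ad R)%type) :=
  row_hom 2 [:: (e 2, 0); (0, e 2); (0, e 4)].
have fE x : f x =
    (coordinate x 1 *: e 2, coordinate x 2 *: e 2 + coordinate x 3 *: e 4).
  by rewrite [LHS]row_hom3E; congr (_, _) => /=; rewrite !scaler0 ?addr0 ?add0r.
apply: (hol_isomorphic_aff (f := f) (@quad_alg_unit _ _)).
- by rewrite !dimvf.
- exact: prod_J_abelian (affR_J_abelian R) (affR_ad_J_abelian R).
- apply/lker0P => x y; rewrite !fE => -[xy1 xy2].
  move: (congr1 (coord 2) xy1) (congr1 (coord 2) xy2) (congr1 (coord 4) xy2).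
  coordinate_simp; rewrite !(mulr1, mulr0, addr0, add0r) => *.
  by apply: coordinateP => i; index_cases i.
- by move=> x y; rewrite !fE; congr (_, _); apply: coordinateP => i hi;
    coordinate_simp; ring.
- by move=> x y; rewrite !fE prod_JE; congr (_, _); apply: coordinateP => i hi;
    coordinate_simp; ring.
Qed.

Lemma affR3_aff :
  hol_isomorphic (aff_J (quad_alg (1 : R)))
    (prod_J (prod_J (affR_J R) (affR_J R)) (affR_J R)).
Proof.
(* In [R x R] the roles of [1] and of [t] with [t^2 = 1] are played by [(1, 1)] and [(1, -1)]. *)
pose f : 'Hom(quad_alg (1 : R), (affR R * affR R * affR R)%type) :=
  row_hom 2 [:: (e 2, 0, 0); (0, e 2, e 2); (0, e 2, - e 2)].
have fE x : f x =
    (coordinate x 1 *: e 2, (coordinate x 2 + coordinate x 3) *: e 2,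
     (coordinate x 2 - coordinate x 3) *: e 2).
  rewrite [LHS]row_hom3E; congr (_, _, _) => /=;
    rewrite !scaler0 ?addr0 ?add0r ?scalerN //.
  - by rewrite scalerDl.
  - by rewrite scalerBl.
apply: (hol_isomorphic_aff (f := f) (@quad_alg_unit _ _)).
- by rewrite !dimvf.
- apply: prod_J_abelian; last exact: affR_J_abelian.
  exact: prod_J_abelian (affR_J_abelian R) (affR_J_abelian R).
- apply/lker0P => x y; rewrite !fE => -[xy1 xy2 xy3].
  move: (congr1 (coord 2) xy1) (congr1 (coord 2) xy2) (congr1 (coord 2) xy3).
  coordinate_simp; rewrite !mulr1 => h1 h2 h3.
  apply: coordinateP => i; index_cases i; lra.
- by move=> x y; rewrite !fE; congr (_, _, _); apply: coordinateP => i hi;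
    coordinate_simp; ring.
- move=> x y; rewrite !fE !prod_JE /=; congr (_, _, _); apply: coordinateP => i hi;
    coordinate_simp; ring.
Qed.

End ModelsAff.

Lemma abelian_complex (R : numFieldType) (g : lieAlgType R) (J : 'End(g)) :
  abelian_complex_structure J -> complex_structure J.
Proof.
move=> abJ; split=> [|x y]; first exact: abJ.1.
by rewrite abJ.2 subrr sub0r -opprD -linearD acsC // addNr linear0 oppr0.
Qed.

Lemma mulrr_neqN1 (R : realDomainType) (x : R) : x * x != -1.
Proof. by apply/eqP => x2; nra. Qed.

(** * Uniqueness of the complex structures on the factors *)

Section Uniqueness.
Variable R : realFieldType.

(** In dimension 2 the bracket is a determinant times [e 2], and a real [J] with [J^2 = -1] has
    trace 0 and determinant 1. *)
Lemma affR_complex_abelian (J : 'End(affR R)) :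
  complex_structure J -> abelian_complex_structure J.
Proof.
move=> [JK _]; split=> // x y.
have JE z i : coordinate (J z) i =
    coordinate z 1 * coordinate (J (e 1)) i + coordinate z 2 * coordinate (J (e 2)) i.
  have {1}-> : z = coordinate z 1 *: e 1 + coordinate z 2 *: e 2.
    by apply: coordinateP => j; index_cases j; coordinate_simp; ring.
  by rewrite linearD !linearZ /= !coordE.
have JJ z : J (J z) = - z.
  by have /lfunP/(_ z) := JK; rewrite comp_lfunE opp_lfunE id_lfunE.
have J1 := JJ (e 1); have J2 := JJ (e 2).
move: (congr1 (fun v : 'rV_2 => coordinate v 1) J1).
move: (congr1 (fun v : 'rV_2 => coordinate v 2) J1).
move: (congr1 (fun v : 'rV_2 => coordinate v 1) J2).
rewrite !(JE (J _)) !coordE !coordinate_e //= => h1 h2 h3.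
apply: coordinateP => i hi; rewrite !coordinate_lieb /= !(JE x) !(JE y).
rewrite !coordinate_e //=.
move: (coordinate (J (e 1)) 1) (coordinate (J (e 1)) 2) h1 h2 h3.
move: (coordinate (J (e 2)) 1) (coordinate (J (e 2)) 2) => c d a b h1 h2 h3.
have b0 : b != 0.
  apply: contra_eqN h3 => /eqP ->; rewrite mul0r addr0; exact: mulrr_neqN1.
have dE : d = - a.
  apply: (mulfI b0); rewrite mulrN; apply/eqP.
  by rewrite -addr_eq0 addrC [b * a]mulrC h2 oppr0.
have det1 : a * d - b * c = 1 by rewrite dE; lra.
by rewrite -[in RHS](mul1r (_ - _)) -det1; ring.
Qed.

Lemma affR_aff (J : 'End(affR R)) :
  abelian_complex_structure J -> hol_isomorphic (aff_J (base_alg R)) J.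
Proof.
move=> abJ; set c := coordinate (J (e 2)) 1.
have c0 : c != 0.
  (* Otherwise [e 2] would be an eigenvector of [J] with a real eigenvalue of square [-1]. *)
  apply/eqP => c0; have : J (e 2) = coordinate (J (e 2)) 2 *: e 2.
    apply: coordinateP => i; index_cases i; coordinate_simp; last by rewrite mulr1.
    by rewrite mulr0.
  move: (coordinate _ 2) => d J2; have := acsK abJ (e 2).
  rewrite J2 linearZ /= J2 scalerA => /(congr1 (fun v : 'rV_2 => coordinate v 2)).
  by coordinate_simp; nra.
(* As [[e 2, J (e 2)] = - c *: e 2], the vector [- c^-1 *: e 2] is idempotent for the product
   [[x, J y]]. *)
pose f : 'Hom(base_alg R, affR R) := row_hom 0 [:: - c^-1 *: e 2].
have fE x : f x = coordinate x 1 *: (- c^-1 *: e 2) by exact: row_hom1E.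
apply: (hol_isomorphic_aff (f := f) (@base_alg_unit _)) => //.
- by rewrite !dimvf.
- apply/lker0P => x y; rewrite !fE !scalerA => xy.
  move: (congr1 (fun v : 'rV_2 => coordinate v 2) xy); coordinate_simp.
  rewrite !mulr1 => /mulIf; rewrite oppr_eq0 invr_eq0 c0 => /(_ isT) h.
  by apply: coordinateP => i; index_cases i.
- by move=> x y; rewrite !fE; apply: coordinateP => i hi; coordinate_simp; ring.
- move=> x y; rewrite !fE !linearZ /=; apply: coordinateP => i hi.
  coordinate_simp; rewrite -/c; field; exact: c0.
Qed.

Lemma affR_unique :
  unique_up_to_aut (@complex_structure R (affR R)) (affR_J R).
Proof.
split=> [|J /affR_complex_abelian/affR_aff hJ].
  exact/abelian_complex/affR_J_abelian.
exact/(hol_isomorphic_trans (hol_isomorphic_sym hJ))/affR_aff/affR_J_abelian.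
Qed.

Lemma affR_ad_aff (J : 'End(affR_ad R)) :
  abelian_complex_structure J -> hol_isomorphic (aff_J (dual_alg R)) J.
Proof.
move=> abJ; set a := J (e 2); set b := J (e 4).
(* Commutativity of [[x, J y]] at [e 2] and [e 4] determines two coordinates of [J (e 4)]. *)
have ab : lieb b (e 2) = lieb a (e 4) :> affR_ad R.
  by rewrite acsC // liebC opprK.
move: (congr1 (fun v : 'rV_4 => coordinate v 2) ab).
move: (congr1 (fun v : 'rV_4 => coordinate v 4) ab).
coordinate_simp => ab4 ab2.
have b1 : coordinate b 1 = 0 by lra.
have b3 : coordinate b 3 = - coordinate a 1 by lra.
set k := coordinate a 1 in b3.
have k0 : k != 0.
  (* If [k = 0], then [J (e 4)] is a real multiple of [e 4], which [J^2 = -1] excludes. *)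
  apply/eqP => k0; have cb := acsC abJ (e 1) (e 4).
  move: (congr1 (fun v : 'rV_4 => coordinate v 2) cb); rewrite -/b.
  coordinate_simp => b2.
  have bE : b = coordinate b 4 *: e 4.
    by apply: coordinateP => i; index_cases i; coordinate_simp; lra.
  have := acsK abJ (e 4); rewrite -/b {1}bE linearZ /= -/b {2}bE scalerA.
  by move/(congr1 (fun v : 'rV_4 => coordinate v 4)); coordinate_simp; nra.
(* The products are [e2 e2 = - k e2 + a_3 e4], [e2 e4 = - k e4] and [e4 e4 = 0]; the first vector is
   the unit, the second has square zero. *)
pose f : 'Hom(dual_alg R, affR_ad R) :=
  row_hom 1 [:: - k^-1 *: (e 2 + (coordinate a 3 / k) *: e 4); - k^-1 *: e 4].
have fE x : f x =
    coordinate x 1 *: (- k^-1 *: (e 2 + (coordinate a 3 / k) *: e 4)) +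
    coordinate x 2 *: (- k^-1 *: e 4) by exact: row_hom2E.
apply: (hol_isomorphic_aff (f := f) (@dual_alg_unit _)) => //.
- by rewrite !dimvf.
- apply/lker0P => x y; rewrite !fE => xy.
  move: (congr1 (fun v : 'rV_4 => coordinate v 2) xy).
  move: (congr1 (fun v : 'rV_4 => coordinate v 4) xy); coordinate_simp.
  rewrite !(mulr1, mulr0, add0r, addr0) => h2 /mulIf.
  rewrite oppr_eq0 invr_eq0 k0 => /(_ isT) h1.
  move: h2; rewrite h1 => /addrI/mulIf; rewrite oppr_eq0 invr_eq0 k0 => /(_ isT) h2.
  by apply: coordinateP => i; index_cases i.
- by move=> x y; rewrite !fE; apply: coordinateP => i hi; coordinate_simp; ring.
- have JfE y : J (f y) =
      coordinate y 1 *: (- k^-1 *: (a + (coordinate a 3 / k) *: b)) +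
      coordinate y 2 *: (- k^-1 *: b).
    have JZ c v : J (c *: v) = c *: J v by exact: linearZ.
    have JD v w : J (v + w) = J v + J w by exact: linearD.
    by rewrite fE JD !JZ JD JZ.
  move=> x y; rewrite JfE !fE; apply: coordinateP => i hi.
  coordinate_simp; rewrite b1 b3 -/k; field; exact: k0.
Qed.

Lemma affR_ad_unique :
  unique_up_to_aut (@abelian_complex_structure R (affR_ad R)) (affR_ad_J R).
Proof.
split=> [|J /affR_ad_aff hJ]; first exact: affR_ad_J_abelian.
exact/(hol_isomorphic_trans (hol_isomorphic_sym hJ))/affR_ad_aff/affR_ad_J_abelian.
Qed.

End Uniqueness.

(** * Independent triples in dimension 3 *)

Section Independence.
Variables (R : fieldType) (V : vectType R).
Implicit Types (v w : V).

Definition indep3 v1 v2 v3 : Prop := forall x y z : R,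
  x *: v1 + y *: v2 + z *: v3 = 0 -> [/\ x = 0, y = 0 & z = 0].

Lemma indep3_lker v1 v2 v3 :
  indep3 v1 v2 v3 -> lker (row_hom 2 [:: v1; v2; v3]) == 0%VS.
Proof.
move=> indv; apply/lker0P/raddf_inj => x.
rewrite -[X in X = _]/(row_hom 2 [:: v1; v2; v3] x) row_hom3E => /indv[x1 x2 x3].
by apply: coordinateP => i; rewrite coordinate0; index_cases i.
Qed.

Lemma indep3_span v1 v2 v3 : \dim {:V} = 3%N -> indep3 v1 v2 v3 ->
  forall v, exists x y z, v = x *: v1 + y *: v2 + z *: v3.
Proof.
move=> dV /indep3_lker f0 v.
have [|g _ gK] := lker0_bij f0; first by rewrite dV dimvf.
by rewrite -[v]gK row_hom3E; do 3 eexists.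
Qed.

Lemma exists_not_line v1 : (1 < \dim {:V})%N -> exists v, v \notin <[v1]>%VS.
Proof.
move=> dV; apply/not_existsP => allv; move: dV; rewrite ltnNge => /negP; apply.
suff -> : fullv = <[v1]>%VS by rewrite dim_vline; case: (v1 != 0).
apply/eqP; rewrite eq_sym eqEsubv subvf; apply/subvP => v _.
by have /negP/negPn := allv v.
Qed.

Lemma exists_indep3 v1 v2 : \dim {:V} = 3%N -> v1 != 0 -> v2 \notin <[v1]>%VS ->
  exists v3, indep3 v1 v2 v3.
Proof.
move=> dV v10 v2v1.
have [v3 v3n] : exists v3, v3 \notin <<[:: v1; v2]>>%VS.
  apply/not_existsP => allv; have := dim_span [:: v1; v2].
  suff -> : <<[:: v1; v2]>>%VS = fullv by rewrite dV.
  apply/eqP; rewrite eqEsubv subvf; apply/subvP => v _.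
  by have /negP/negPn := allv v.
exists v3 => x y z xyz.
have z0 : z = 0.
  apply: contraNeq v3n => z0.
  have -> : v3 = - z^-1 *: (x *: v1 + y *: v2).
    move/eqP: xyz; rewrite addr_eq0 => /eqP ->.
    by rewrite scaleNr scalerN opprK scalerA mulVf ?scale1r.
  by rewrite rpredZ // rpredD // rpredZ // memv_span // !inE eqxx ?orbT.
move: xyz; rewrite z0 scale0r addr0 => xy.
have y0 : y = 0.
  apply: contraNeq v2v1 => y0.
  have -> : v2 = (- y^-1 * x) *: v1.
    move/eqP: xy; rewrite addrC addr_eq0 => /eqP /(congr1 ( *:%R y^-1)).
    by rewrite scalerA mulVf // scale1r scalerN scalerA -scaleNr mulNr.
  exact/memvZ/memv_line.
move: xy; rewrite y0 scale0r addr0 => /eqP.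
by rewrite scaler_eq0 (negPf v10) orbF => /eqP.
Qed.

End Independence.

(** * Unital algebras as rings, and recognition of the models in them *)

Section UnitalAlgebras.
Variables (R : fieldType) (A : comAssocAlgType R) (u : A).
Hypotheses (u1 : forall x, amul u x = x) (u0 : u != 0).

(** A copy of [A] indexed by its unit, so that a commutative ring structure with this [1] can be
    attached to it. *)
Definition unital_alg (_ : forall x, amul u x = x) (_ : u != 0) : Type := A.

Local Notation B := (unital_alg u1 u0).

HB.instance Definition _ := Vector.copy B A.

Fact unital_alg_mulDl : left_distributive (@amul R A) +%R.
Proof. by move=> x y z; rewrite amulDl. Qed.

HB.instance Definition _ := GRing.Zmodule_isComNzRing.Build B
  (@amulA R A) (@amulC R A) u1 unital_alg_mulDl u0.

HB.instance Definition _ := GRing.Lmodule_isLalgebra.Build R B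
  (fun a x y => esym (amulZl a x y)).

HB.instance Definition _ := GRing.Lalgebra_isComAlgebra.Build R B.

(** Turns scalars into ring elements, so that [ring] can prove identities mixing scaling and
    products. *)
Lemma scale_in_alg a (x : B) : a *: x = in_alg B a * x.
Proof. by rewrite mulr_algl. Qed.

Lemma quad_alg_embeds d (b1 b2 b3 : B) :
  b1 * b1 = b1 -> b1 * b2 = 0 -> b1 * b3 = 0 -> b2 * b2 = b2 -> b2 * b3 = b3 ->
  b3 * b3 = d *: b2 -> indep3 b1 b2 b3 -> alg_embeds (quad_alg d) A.
Proof.
move=> b11 b12 b13 b22 b23 b33 /indep3_lker f0.
have prodE x1 x2 x3 y1 y2 y3 :
    (x1 *: b1 + x2 *: b2 + x3 *: b3) * (y1 *: b1 + y2 *: b2 + y3 *: b3) =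
    (x1 * y1) *: b1 + (x2 * y2 + x3 * y3 * d) *: b2 + (x2 * y3 + x3 * y2) *: b3.
  rewrite !scale_in_alg in b33 *.
  transitivity (in_alg B (x1 * y1) * (b1 * b1)
    + in_alg B (x1 * y2 + x2 * y1) * (b1 * b2)
    + in_alg B (x1 * y3 + x3 * y1) * (b1 * b3) + in_alg B (x2 * y2) * (b2 * b2)
    + in_alg B (x2 * y3 + x3 * y2) * (b2 * b3) + in_alg B (x3 * y3) * (b3 * b3)).
    by ring.
  by rewrite b11 b12 b13 b22 b23 b33; ring.
exists (row_hom 2 [:: b1; b2; b3] : 'Hom(quad_alg d, A)) => // x y.
rewrite !row_hom3E; apply: etrans (esym (prodE _ _ _ _ _ _)).
by congr (_ *: _ + _ *: _ + _ *: _); coordinate_simp; ring.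
Qed.

Lemma local_alg_embeds p (x y : B) :
  x * x = p *: y -> x * y = 0 -> y * y = 0 -> indep3 (1 : B) x y ->
  alg_embeds (local_alg p) A.
Proof.
move=> xx xy yy /indep3_lker f0.
have prodE x1 x2 x3 y1 y2 y3 :
    (x1 *: 1 + x2 *: x + x3 *: y) * (y1 *: 1 + y2 *: x + y3 *: y) =
    (x1 * y1) *: 1 + (x1 * y2 + x2 * y1) *: x +
    (x1 * y3 + x3 * y1 + x2 * y2 * p) *: y.
  rewrite !scale_in_alg in xx *.
  transitivity (in_alg B (x1 * y1) + in_alg B (x1 * y2 + x2 * y1) * x
    + in_alg B (x1 * y3 + x3 * y1) * y + in_alg B (x2 * y2) * (x * x)
    + in_alg B (x2 * y3 + x3 * y2) * (x * y) + in_alg B (x3 * y3) * (y * y)).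
    by ring.
  by rewrite xx xy yy; ring.
exists (row_hom 2 [:: 1 : B; x; y] : 'Hom(local_alg p, A)) => // v w.
rewrite !row_hom3E; apply: etrans (esym (prodE _ _ _ _ _ _)).
by congr (_ *: _ + _ *: _ + _ *: _); coordinate_simp; ring.
Qed.

End UnitalAlgebras.

(** The intermediate value theorem on [[- m, m]], with [m] so large that the cube dominates the
    lower terms at both ends. *)
Lemma cubic_root (R : rcfType) (b c d : R) :
  exists t, t ^+ 3 = b * t ^+ 2 + c * t + d.
Proof.
pose p : {poly R} := 'X^3 - (b *: 'X^2 + c *: 'X + d%:P).
have pE t : p.[t] = t ^+ 3 - (b * t ^+ 2 + c * t + d).
  by rewrite !(hornerD, hornerN, hornerZ, hornerXn, hornerX, hornerC).
pose m := 1 + `|b| + `|c| + `|d|.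
have m1 : 1 <= m by rewrite /m -!addrA lerDl !addr_ge0.
have bm t : `|t| = m -> `|b * t ^+ 2 + c * t + d| <= m ^+ 3.
  move=> tm; apply: le_trans (ler_normD _ _) _.
  apply: le_trans (lerD (ler_normD _ _) (lexx _)) _.
  rewrite [`|b * _|]normrM [`|c * _|]normrM normrX tm.
  have b0 := normr_ge0 b; have c0 := normr_ge0 c; have d0 := normr_ge0 d.
  have m2 : m <= m ^+ 2 by rewrite expr2 ler_peMl // (le_trans ler01).
  have -> : m ^+ 3 = (1 + `|b| + `|c| + `|d|) * m ^+ 2 by rewrite exprS.
  have cm : `|c| * m <= `|c| * m ^+ 2 by rewrite ler_wpM2l.
  have dm : `|d| <= `|d| * m ^+ 2 by rewrite ler_peMr // (le_trans m1).
  have m20 : 0 <= m ^+ 2 by rewrite sqr_ge0.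
  by rewrite !mulrDl; lra.
have m0 : 0 <= m by rewrite (le_trans ler01).
have [||t _ /rootP pt] := @poly_ivt R p (- m) m.
- by rewrite (le_trans _ m0) ?oppr_le0.
- rewrite !pE; have := bm m (ger0_norm m0); have := bm (- m).
  rewrite normrN (ger0_norm m0) => /(_ erefl); rewrite !ler_norml.
  move=> /andP[h1 h2] /andP[h3 h4].
  by apply/andP; split; [rewrite exprS mulNr sqrrN -exprS; lra | lra].
- by exists t; apply/eqP; rewrite -subr_eq0 -pE pt.
Qed.

(** [R^3], [R x C], [R x R[t]/(t^2)], [R[t]/(t^3)] and [R[t, u]/(t, u)^2], in the order of the five
    Lie algebras of the theorem. *)
Definition model_alg (R : fieldType) (k : 'I_5) : comAssocAlgType R :=
  nth (quad_alg 0)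
    [:: quad_alg 1; quad_alg (-1); quad_alg 0; local_alg 1; local_alg 0] k.

(** * Classification of the unital algebras of dimension 3 *)

Section Classification.
Variables (R : rcfType) (A : comAssocAlgType R) (u : A).
Hypotheses (u1 : forall x, amul u x = x) (u0 : u != 0).
Local Notation B := (unital_alg u1 u0).
Implicit Types x y : B.

(** Dividing [b3] by the square root of [|d|] reduces [d] to its sign. *)
Lemma embeds_quad_model (d : R) (b1 b2 b3 : B) :
  b1 * b1 = b1 -> b1 * b2 = 0 -> b1 * b3 = 0 -> b2 * b2 = b2 -> b2 * b3 = b3 ->
  b3 * b3 = d *: b2 -> indep3 b1 b2 b3 ->
  exists k, alg_embeds (model_alg R k) A.
Proof.
move=> b11 b12 b13 b22 b23 b33 indb.
have [d0|d0] := eqVneq d 0.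
  exists (Ordinal (isT : 2 < 5)%N).
  by apply: quad_alg_embeds b11 b12 b13 b22 b23 _ indb; rewrite b33 d0.
pose r := Num.sqrt `|d|; have r0 : r != 0 by rewrite sqrtr_eq0 -ltNge normr_gt0.
have rr : r * r = `|d| by rewrite -expr2 sqr_sqrtr.
have emb : alg_embeds (quad_alg (d / `|d|)) A.
  apply: (quad_alg_embeds (b3 := r^-1 *: b3) b11 b12 _ b22).
  - by rewrite -scalerAr b13 scaler0.
  - by rewrite -scalerAr b23.
  - by rewrite -scalerAl -scalerAr b33 !scalerA -invfM rr mulrC.
  - move=> x1 x2 x3; rewrite scalerA => /indb[-> -> /eqP].
    by rewrite mulf_eq0 invr_eq0 (negPf r0) orbF => /eqP ->.
have [dp|dn] := ltrP 0 d.
  exists (Ordinal (isT : 0 < 5)%N); move: emb.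
  by rewrite gtr0_norm // divff.
exists (Ordinal (isT : 1 < 5)%N); move: emb.
by rewrite ler0_norm // invrN mulrN divff.
Qed.

(* [x] is a simple root of its cubic at [0], so [1 - b2] is the idempotent
   attached to that root and [b2] carries the remaining quadratic factor. *)
Lemma embeds_model_of_nonzero_root x (b c : R) :
    indep3 (1 : B) x (x * x) -> x * x * x = b *: (x * x) + c *: x -> c != 0 ->
  exists k, alg_embeds (model_alg R k) A.
Proof.
move=> indx x3 c0; pose b2 : B := c^-1 *: (x * x - b *: x).
(* Completing the square in [x^2 = b x + c b2], where [b2] acts as the identity on [x]. *)
pose y : B := x - (b / 2) *: b2.
have xb2 : x * b2 = x.
  rewrite -scalerAr mulrBr -scalerAr mulrA x3 addrAC subrr add0r scalerA mulVf //.
  by rewrite scale1r.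
have b22 : b2 * b2 = b2.
  by rewrite {1}/b2 -scalerAl mulrBl -mulrA xb2 -scalerAl xb2.
have b2y : b2 * y = y by rewrite mulrBr mulrC xb2 -scalerAr b22.
have xx : x * x = c *: b2 + b *: x.
  by rewrite scalerA divff // scale1r subrK.
have yy : y * y = (b ^+ 2 / 4 + c) *: b2.
  have : y * y = x * x - b *: (x * b2) + (b / 2) ^+ 2 *: (b2 * b2).
    rewrite /y !scale_in_alg; have two : in_alg B b = in_alg B (b / 2) *+ 2.
      by rewrite -rmorphMn /= -mulr_natr divfK // pnatr_eq0.
    by rewrite two; ring.
  move=> ->; rewrite xx xb2 b22 addrK -scalerDl; congr (_ *: _).
  by field.
apply: (embeds_quad_model (b1 := 1 - b2) (b2 := b2) (b3 := y) _ _ _ b22 b2y yy).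
- by rewrite mulrBr mulr1 mulrBl mul1r b22 subrr subr0.
- by rewrite mulrBl b22 mul1r subrr.
- by rewrite mulrBl b2y mul1r subrr.
- move=> a m n e0.
  (* The coefficients of [a (1 - b2) + m b2 + n y] on [1, x, x^2]. *)
  have := indx a (n - b * ((m - a - n * (b / 2)) / c)) ((m - a - n * (b / 2)) / c).
  case.
    rewrite -[RHS]e0 /y /b2 !scale_in_alg. 
    ring.
  move=> -> + /eqP; rewrite mulf_eq0 invr_eq0 (negPf c0) orbF => + /eqP h.
  rewrite h mul0r mulr0 subr0 => n0; move: h; rewrite n0 => h.
  split=> //; lra.
Qed.

(** Translating [x] by a root [t] removes the constant term of its cubic and leaves minus the
    derivative at [t] as linear coefficient, which is nonzero exactly when [t] is a simple root. At
    a triple root [(x - t)^3 = 0]. *)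
Lemma embeds_model_of_cubic x (b c d : R) :
    indep3 (1 : B) x (x * x) ->
    x * x * x = b *: (x * x) + c *: x + d *: 1 ->
  exists k, alg_embeds (model_alg R k) A.
Proof.
move=> indx x3; have [t t3] := cubic_root b c d.
have shift (r : R) : indep3 (1 : B) (x - r *: 1) ((x - r *: 1) * (x - r *: 1)).
  move=> a m n e0.
  have := indx (a - m * r + n * r ^+ 2) (m - 2 * n * r) n; case.
    rewrite -[RHS]e0 !scale_in_alg; ring.
  move=> h1 h2 n0; move: h2 h1; rewrite n0 mulr0 !mul0r subr0 addr0 => ->.
  by rewrite mul0r subr0.
have cubic_at (r : R) : r ^+ 3 = b * r ^+ 2 + c * r + d ->
    (x - r *: 1) * (x - r *: 1) * (x - r *: 1) =
    (b - 3 * r) *: ((x - r *: 1) * (x - r *: 1)) +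
    (c + 2 * b * r - 3 * r ^+ 2) *: (x - r *: 1).
  move=> r3; have dE : d = r ^+ 3 - b * r ^+ 2 - c * r by rewrite r3; ring.
  have -> : (x - r *: 1) * (x - r *: 1) * (x - r *: 1) = x * x * x
      - (3 * r) *: (x * x) + (3 * r ^+ 2) *: x - r ^+ 3 *: 1.
    rewrite !scale_in_alg; ring.
  rewrite x3 dE !scale_in_alg; ring.
have x3t := cubic_at t t3; have indt := shift t.
have [c0|c0] := eqVneq (c + 2 * b * t - 3 * t ^+ 2) 0; last first.
  exact: embeds_model_of_nonzero_root indt x3t c0.
have [b0|b0] := eqVneq (b - 3 * t) 0.
  move: x3t; rewrite c0 b0 !scale0r addr0 => x3t.
  exists (Ordinal (isT : 3 < 5)%N).
  apply: (local_alg_embeds (x := x - t *: 1) _ _ _ indt).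
  - by rewrite scale1r.
  - by rewrite mulrA.
  - by rewrite mulrA x3t mul0r.
(* [t] is exactly a double root, so [b - 2 t] is a simple one. *)
pose t' := b - 2 * t.
have cE : c = 3 * t ^+ 2 - 2 * b * t by lra.
have t'3 : t' ^+ 3 = b * t' ^+ 2 + c * t' + d.
  have -> : d = t ^+ 3 - b * t ^+ 2 - c * t by rewrite t3; ring.
  by rewrite /t' cE; ring.
have ct' : c + 2 * b * t' - 3 * t' ^+ 2 != 0.
  have -> : c + 2 * b * t' - 3 * t' ^+ 2 = - (b - 3 * t) ^+ 2.
    by rewrite /t' cE; ring.
  by rewrite oppr_eq0 expf_eq0.
exact: embeds_model_of_nonzero_root (shift t') (cubic_at t' t'3) ct'.
Qed.

(** Completing squares gives [1, x, y] independent with [x^2 = p], [y^2 = q] scalar. In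
    [x y = l + m x + n y], the quadratic equations of [x + y] and [x - y] give [n = m] and
    [n = - m]; then associativity on [x x y] and [x y y] gives [l = p = q = 0]. *)
Lemma embeds_model_of_quadratic :
  \dim {:A} = 3%N ->
  (forall x, x \notin <[1 : B]>%VS -> exists b c : R, x * x = b *: x + c *: 1) ->
  exists k, alg_embeds (model_alg R k) A.
Proof.
move=> dA quad; have dB : \dim {:B} = 3%N by [].
have /(exists_not_line (V := B) 1)[x0 x0n] : (1 < \dim {:B})%N by rewrite dB.
have [y0 ind0] := exists_indep3 dB (oner_neq0 B) x0n.
have notin1 (v : B) : (forall m n : R, m *: 1 + n *: v = 0 -> n = 0) ->
    v \notin <[1 : B]>%VS.
  move=> ind; apply/negP => /vlineP[k vk].
  suff /eqP : (1 : R) = 0 by rewrite oner_eq0.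
  by apply: (ind (- k)); rewrite vk scaleNr scale1r addNr.
have y0n : y0 \notin <[1 : B]>%VS.
  by apply: notin1 => m n e0; have [] := ind0 m 0 n; rewrite // scale0r addr0.
have [b [c x0E]] := quad _ x0n; have [b' [c' y0E]] := quad _ y0n.
pose x := x0 - (b / 2) *: 1; pose y := y0 - (b' / 2) *: 1.
have two (r : R) : in_alg B r = in_alg B (r / 2) *+ 2.
  by rewrite -rmorphMn /= -mulr_natr divfK // pnatr_eq0.
have square (v : B) (r q : R) : v * v = r *: v + q *: 1 ->
    exists q' : R, (v - (r / 2) *: 1) * (v - (r / 2) *: 1) = q' *: 1.
  move=> vv; exists (q + (r / 2) ^+ 2).
  have -> : (v - (r / 2) *: 1) * (v - (r / 2) *: 1) =
      v * v - r *: v + (r / 2) ^+ 2 *: 1.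
    by rewrite !scale_in_alg (two r); ring.
  by rewrite vv [_ + _ - _]addrAC subrr add0r scalerDl.
have [p xx] := square _ _ _ x0E; have [q yy] := square _ _ _ y0E.
rewrite -/x -/y in xx yy.
have indx : indep3 (1 : B) x y.
  move=> l m n e0; have := ind0 (l - m * (b / 2) - n * (b' / 2)) m n; case.
    by rewrite -[RHS]e0 /x /y !scale_in_alg; ring.
  by move=> + m0 n0; rewrite m0 n0 !mul0r !subr0.
have [l [m [n xyE]]] := indep3_span dB indx (x * y).
have sum_notin (s : R) : x + s *: y \notin <[1 : B]>%VS.
  apply: notin1 => m' n' e0; have [] := indx m' n' (n' * s); last by [].
  by rewrite -[RHS]e0 !scale_in_alg; ring.
have mn (s : R) : s ^+ 2 = 1 -> n = s * m.
  move=> s2; have [b1 [c1 sq]] := quad _ (sum_notin s).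
  have [] := indx (p + s ^+ 2 * q + 2 * s * l - c1) (2 * s * m - b1)
      (2 * s * n - s * b1).
    have : (x + s *: y) * (x + s *: y) =
      x * x + s ^+ 2 *: (y * y) + (2 * s) *: (x * y).
      by rewrite !scale_in_alg; ring.
    rewrite sq xx yy xyE => /eqP; rewrite eq_sym -subr_eq0 => /eqP e0.
    by rewrite -[RHS]e0 !scale_in_alg; ring.
  move=> _ h1 h2; have b1E : b1 = 2 * s * m by lra.
  have sn : s * n = s ^+ 2 * m by rewrite b1E in h2; lra.
  by rewrite -[LHS]mul1r -s2 expr2 -mulrA sn s2 mul1r.
have nm : n = m by rewrite (mn 1) ?mul1r ?expr1n.
have nm' : n = - m by rewrite (mn (-1)) ?mulN1r // sqrrN expr1n.
have m0 : m = 0 by lra.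
have n0 : n = 0 by lra.
move: xyE; rewrite m0 n0 !scale0r !addr0 => xyE.
have [|_ l0 p0] := indx 0 l (- p).
  have : x * (x * y) = x * x * y by rewrite mulrA.
  rewrite xyE xx scale0r add0r scaleNr -scalerAr -scalerAl mulr1 mul1r => ->.
  by rewrite subrr.
have [|_ q0 _] := indx 0 q 0.
  have : x * (y * y) = x * y * y by rewrite mulrA.
  by rewrite xyE yy l0 !scale0r mul0r add0r addr0 -scalerAr mulr1.
exists (Ordinal (isT : 4 < 5)%N).
apply: (local_alg_embeds (x := x) (y := y) _ _ _ indx).
- by rewrite scale0r xx -[p]opprK p0 oppr0 scale0r.
- by rewrite xyE l0 scale0r.
- by rewrite yy q0 scale0r.
Qed.

Lemma unital_dim3_model :
  \dim {:A} = 3%N -> exists k, alg_embeds (model_alg R k) A.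
Proof.
move=> dA; have dB : \dim {:B} = 3%N by [].
have [[x indx]|no_gen] := pselect (exists x : B, indep3 (1 : B) x (x * x)).
  have [a [b [c x3]]] := indep3_span dB indx (x * x * x).
  apply: (embeds_model_of_cubic (x := x) (b := c) (c := b) (d := a)) => //.
  by rewrite x3 addrC [a *: 1 + _]addrC addrA.
apply: embeds_model_of_quadratic => // x xn.
have /existsNP[a /existsNP[b /existsNP[c /not_implyP[e0 n0]]]] :
    ~ indep3 (1 : B) x (x * x) by move=> ind; apply: no_gen; exists x.
(* A dependency among [1, x, x^2] must involve [x^2], since [x] is not a scalar. *)
have c0 : c != 0.
  apply: contra_notN n0 => /eqP c0; move: e0; rewrite c0 scale0r addr0 => ab0.
  have b0 : b = 0.
    apply: contraNeq xn => b0; apply/vlineP; exists (- b^-1 * a).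
    move/eqP: ab0; rewrite addrC addr_eq0 => /eqP/(congr1 ( *:%R b^-1)).
    by rewrite scalerA mulVf // scale1r scalerN scalerA -scaleNr mulNr.
  move/eqP: ab0; rewrite b0 scale0r addr0 scaler_eq0 oner_eq0 orbF => /eqP a0.
  by split.
exists (- c^-1 * b), (- c^-1 * a).
move/eqP: e0; rewrite addrC addr_eq0 => /eqP/(congr1 ( *:%R c^-1)).
rewrite scalerA mulVf // scale1r => ->.
by rewrite -!scalerA !scaleNr -opprD -scalerDr addrC scalerN.
Qed.

End Classification.

(** * Invariants separating the model algebras *)

Section Invariants.
Variable R : realFieldType.

Lemma quad1_sum_squares (x y : quad_alg (1 : R)) :
  amul x x + amul y y = 0 -> x = 0.
Proof.
move=> xy; have coordxy i : coordinate (amul x x + amul y y) i = 0.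
  by rewrite xy coordinate0.
move: (coordxy 1) (coordxy 2); coordinate_simp => h1 h2.
by apply: coordinateP => i; rewrite coordinate0; index_cases i; nra.
Qed.

Lemma quadN1_reduced (x : quad_alg (-1 : R)) : amul x x = 0 -> x = 0.
Proof.
move=> xx; have coordxx i : coordinate (amul x x) i = 0 by rewrite xx coordinate0.
move: (coordxx 1) (coordxx 2) (coordxx 3); coordinate_simp => h1 h2 h3.
have x2 : coordinate x 2 = 0.
  have /eqP : coordinate x 2 * coordinate x 3 = 0 by lra.
  by rewrite mulf_eq0 => /orP[/eqP -> //|/eqP x3]; rewrite x3 in h2; nra.
rewrite x2 in h2.
by apply: coordinateP => i; rewrite coordinate0; index_cases i; nra.
Qed.

(** The elements with first coordinate [0] form the maximal ideal, which is nilpotent and so has no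
    nonzero idempotent. *)
Lemma local_idempotent p (x : local_alg (p : R)) :
  coordinate x 1 = 0 -> amul x x = x -> x = 0.
Proof.
move=> x1 xx.
have coordxx i : coordinate (amul x x) i = coordinate x i by rewrite xx.
move: (coordxx 2) (coordxx 3); coordinate_simp; rewrite x1 => h2 h3.
have x2 : coordinate x 2 = 0 by lra.
rewrite x2 in h3.
by apply: coordinateP => i; rewrite coordinate0; index_cases i; lra.
Qed.

(** The first coordinate is multiplicative, so it vanishes on one of the two idempotents. *)
Lemma local_orth_idempotents p (x y : local_alg (p : R)) :
  amul x x = x -> amul y y = y -> amul x y = 0 -> x = 0 \/ y = 0.
Proof.
move=> xx yy xy; have : coordinate x 1 * coordinate y 1 = 0.
  have := congr1 (fun v : 'rV_3 => coordinate v 1) xy.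
  by coordinate_simp; lra.
move/eqP; rewrite mulf_eq0 => /orP[] /eqP.
  by move=> x1; left; apply: local_idempotent.
by move=> y1; right; apply: local_idempotent.
Qed.

Lemma local0_cube (x : local_alg (0 : R)) :
  amul x (amul x x) = 0 -> amul x x = 0.
Proof.
move=> x3; have := congr1 (fun v : 'rV_3 => coordinate v 1) x3; coordinate_simp.
move=> h; have /eqP : coordinate x 1 ^+ 3 = 0 by rewrite !exprS expr0; lra.
rewrite expf_eq0 /= => /eqP x1.
by apply: coordinateP => i hi; coordinate_simp; rewrite x1; ring.
Qed.

Lemma e_neq0 n i : (0 < i <= n.+1)%N -> (e i : 'rV[R]_n.+1) != 0.
Proof.
move=> hi; apply/eqP => /(congr1 (fun v : 'rV_n.+1 => coordinate v i)).
by rewrite coordinate_e // coordinate0 eqxx => /eqP; rewrite oner_eq0.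
Qed.

Lemma quad1_embeds (A : comAssocAlgType R) (x y : A) :
  alg_embeds A (quad_alg 1) -> amul x x + amul y y = 0 -> x = 0.
Proof.
move=> [f f0 fM] xy; apply: (lker0P f0); rewrite linear0.
by apply: (@quad1_sum_squares _ (f y)); rewrite -!fM -linearD xy linear0.
Qed.

Lemma quadN1_embeds (A : comAssocAlgType R) (x : A) :
  alg_embeds A (quad_alg (-1)) -> amul x x = 0 -> x = 0.
Proof.
move=> [f f0 fM] xx; apply: (lker0P f0); rewrite linear0.
by apply: quadN1_reduced; rewrite -fM xx linear0.
Qed.

Lemma local_embeds (A : comAssocAlgType R) p (x y : A) :
  alg_embeds A (local_alg p) ->
  amul x x = x -> amul y y = y -> amul x y = 0 -> x = 0 \/ y = 0.
Proof.
move=> [f f0 fM] xx yy xy.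
have [||| fx|fy] := @local_orth_idempotents p (f x) (f y).
- by rewrite -fM xx.
- by rewrite -fM yy.
- by rewrite -fM xy linear0.
- by left; apply: (lker0P f0); rewrite linear0.
- by right; apply: (lker0P f0); rewrite linear0.
Qed.

Lemma local0_embeds (A : comAssocAlgType R) (x : A) :
  alg_embeds A (local_alg 0) -> amul x (amul x x) = 0 -> amul x x = 0.
Proof.
move=> [f f0 fM] x3; apply: (lker0P f0); rewrite linear0 fM.
by apply: local0_cube; rewrite -!fM x3 linear0.
Qed.

(* The models are separated, in this order, by: [x^2 + y^2 = 0] forces [x = 0];
   [x^2 = 0] forces [x = 0]; there are two orthogonal idempotents; [x^3 = 0]
   forces [x^2 = 0]. *)
Lemma model_alg_lt_neq (k l : 'I_5) : (k < l)%N ->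
  alg_embeds (model_alg R k) (model_alg R l) ->
  alg_embeds (model_alg R l) (model_alg R k) -> False.
Proof.
have nil_quad0 : @amul R (quad_alg 0) (e 3) (e 3) = 0.
  by apply: coordinateP => i hi; coordinate_simp; ring.
have nil_local p : @amul R (local_alg p) (e 3) (e 3) = 0.
  by apply: coordinateP => i hi; coordinate_simp; ring.
have e_false i : (0 < i <= 3)%N -> (e i : 'rV[R]_3) = 0 -> False.
  by move=> hi /eqP; apply/negP/e_neq0.
have not_quad1 (A : comAssocAlgType R) (x : A) :
    amul x x = 0 -> alg_embeds A (quad_alg 1) -> x = 0.
  move=> xx emb; apply: (quad1_embeds (y := 0) emb).
  by rewrite xx linear0 addr0.
have quad0_not_local p : alg_embeds (quad_alg 0) (local_alg (p : R)) -> False.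
  move=> emb; have [||||] := @local_embeds (quad_alg 0) p (e 1) (e 2) emb.
  - by apply: coordinateP => i hi; coordinate_simp; ring.
  - by apply: coordinateP => i hi; coordinate_simp; ring.
  - by apply: coordinateP => i hi; coordinate_simp; ring.
  - exact: e_false.
  - exact: e_false.
(* The ten pairs come in lexicographic order; in [R x C] the relation used is [e2^2 + e3^2 = 0]. *)
case: k l => [[|[|[|[|[|//]]]]] ki] [[|[|[|[|[|//]]]]] li] //= _;
  rewrite /model_alg /= => kl lk.
- apply: (e_false 2) => //; apply: (@quad1_embeds (quad_alg (-1)) (e 2) (e 3) lk).
  by apply: coordinateP => i hi; coordinate_simp; ring.
- exact: e_false (not_quad1 _ _ nil_quad0 lk).
- exact: e_false (not_quad1 _ _ (nil_local 1) lk).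
- exact: e_false (not_quad1 _ _ (nil_local 0) lk).
- exact: e_false (quadN1_embeds lk nil_quad0).
- exact: e_false (quadN1_embeds lk (nil_local 1)).
- exact: e_false (quadN1_embeds lk (nil_local 0)).
- exact: quad0_not_local kl.
- exact: quad0_not_local kl.
- have e22 : @amul R (local_alg 1) (e 2) (e 2) = e 3.
    by apply: coordinateP => i hi; coordinate_simp; ring.
  apply: (e_false 3) => //; rewrite -e22; apply: (local0_embeds kl).
  by rewrite e22; apply: coordinateP => i hi; coordinate_simp; ring.
Qed.

Lemma model_alg_unit (i : 'I_5) :
  exists u : model_alg R i, forall x, amul u x = x.
Proof.
case: i => [[|[|[|[|[|//]]]]] ii]; rewrite /model_alg /=.
- by exists (e 1 + e 2) => x; apply: quad_alg_unit.
- by exists (e 1 + e 2) => x; apply: quad_alg_unit.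
- by exists (e 1 + e 2) => x; apply: quad_alg_unit.
- by exists (e 1) => x; apply: local_alg_unit.
- by exists (e 1) => x; apply: local_alg_unit.
Qed.

Lemma hol_isomorphic_model_inj (k l : 'I_5) :
  hol_isomorphic (aff_J (model_alg R k)) (aff_J (model_alg R l)) -> k = l.
Proof.
move=> kl.
have [uk uk1] := model_alg_unit k; have [ul ul1] := model_alg_unit l.
have ekl := hol_isomorphic_embeds uk1 kl.
have elk := hol_isomorphic_embeds ul1 (hol_isomorphic_sym kl).
case: (ltngtP k l) => [lt|lt|/val_inj //].
  by case: (model_alg_lt_neq lt ekl elk).
by case: (model_alg_lt_neq lt elk ekl).
Qed.

End Invariants.

(** * Assembly of the theorem *)

Lemma dim_model_alg (R : fieldType) k : \dim {: model_alg R k} = 3%N.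
Proof. by rewrite dimvf; case: k => [[|[|[|[|[|//]]]]] ii]. Qed.

Lemma nth_model_aff (R : realFieldType) (s : lieAlgType R) (J : 'End(s))
    (k : 'I_5) :
  nth False [::
    hol_isomorphic J (prod_J (prod_J (affR_J R) (affR_J R)) (affR_J R));
    hol_isomorphic J (prod_J (affR_J R) (affC_J2 R));
    hol_isomorphic J (prod_J (affR_J R) (affR_ad_J R));
    hol_isomorphic J (s3_J R);
    hol_isomorphic J (s4_J R)] k <->
  hol_isomorphic J (aff_J (model_alg R k)).
Proof.
have isoE (g1 g2 : lieAlgType R) (J1 : 'End(g1)) (J2 : 'End(g2)) :
    hol_isomorphic J1 J2 -> hol_isomorphic J J2 <-> hol_isomorphic J J1.
  move=> h; split=> hJ.
    exact: hol_isomorphic_trans hJ (hol_isomorphic_sym h).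
  exact: hol_isomorphic_trans hJ h.
case: k => [[|[|[|[|[|//]]]]] ki]; rewrite /model_alg /=.
- exact/isoE/affR3_aff.
- exact/isoE/affR_affC_aff.
- exact/isoE/affR_affR_ad_aff.
- exact/isoE/s3_aff.
- exact/isoE/s4_aff.
Qed.

Theorem theorem4p6 (R : realType) (s : lieAlgType R) (J : 'End(s)) :
  \dim {: s} = 6%N ->
  abelian_complex_structure J ->
  non_proper J ->
  (\dim (derived s) = 3%N /\
   exists A : comAssocAlgType R,
     [/\ \dim {: A} = 3%N, alg_square A = fullv & hol_isomorphic J (aff_J A)]) /\
  ((exists! k : 'I_5,
     nth False [::
       hol_isomorphic J (prod_J (prod_J (affR_J R) (affR_J R)) (affR_J R));
       hol_isomorphic J (prod_J (affR_J R) (affC_J2 R));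
       hol_isomorphic J (prod_J (affR_J R) (affR_ad_J R));
       hol_isomorphic J (s3_J R);
       hol_isomorphic J (s4_J R)] k) /\
   (* the structures on the factors are unique up to automorphisms *)
   unique_up_to_aut (@complex_structure R (affR R)) (affR_J R) /\
   unique_up_to_aut (@abelian_complex_structure R (affR_ad R)) (affR_ad_J R)).
Proof.
move=> dim6 abJ npJ; split; last first.
  split; last by split; [exact: affR_unique | exact: affR_ad_unique].
  have Jiso := hol_isomorphic_sym (hol_isomorphic_derived_alg abJ npJ dim6).
  have dA := dim_derived_alg abJ npJ dim6.
  have [u u1] := perfect_alg_unit (derived_alg_perfect abJ npJ).
  (* A zero unit would make the algebra zero, against its dimension 3. *)
  have u0 : u != 0.
    apply: contra_eq_neq dA => u_0; rewrite (_ : fullv = 0%VS) ?dimv0 //.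
    apply/eqP; rewrite -subv0; apply/subvP => x _.
    by rewrite memv0 -[x]u1 u_0 amulC linear0.
  have [k emb] := unital_dim3_model u1 u0 dA.
  have [v v1] := model_alg_unit R k.
  have Jk : hol_isomorphic J (aff_J (model_alg R k)).
    apply: hol_isomorphic_trans Jiso (hol_isomorphic_sym _).
    by apply: hol_isomorphic_of_embeds v1 _ emb; rewrite dA dim_model_alg.
  exists k; split=> [|l /nth_model_aff Jl]; first exact/nth_model_aff.
  exact: hol_isomorphic_model_inj (hol_isomorphic_trans (hol_isomorphic_sym Jk) Jl).
split; first exact: dim_derived abJ npJ dim6.
exists (derived_alg abJ : comAssocAlgType R); split.
- exact: dim_derived_alg abJ npJ dim6.
- exact: derived_alg_perfect.
- exact: hol_isomorphic_sym (hol_isomorphic_derived_alg abJ npJ dim6).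
Qed.
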